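(* Let $(\xi_n,\theta_n)_{n\ge0}$ be the skeleton chain of a piecewise deterministic Markov process (PDMP) in $\mathbb R^d$ with deterministic flow $\psi$, and let $f$ be a bounded measurable real-valued function on the state space of the PDMP. Let $\nu$ be the quasistationary distribution (QSD) of $(\xi_n,\theta_n)_{n\ge0}$ in a measurable subset $W$ of the state space of the skeleton chain, suppose that $\mathcal L(\xi_0,\theta_0)=\nu$, and define $M=\inf\{n\ge0:(\xi_n,\theta_n)\notin W\}$, which is assumed finite almost surely. Let $R\ge1$, let $(\xi_0^r,\theta_0^r)$, $r=1,\ldots,R$, be i.i.d. samples from $\nu$, and, using these as starting points, let $((\xi_n^r,\theta_n^r)_{n\ge0})^{r=1,\ldots,R}$ be $R$ independently evolving copies of the skeleton chain. (i) (Synchronous parallel step.) Let $N=\inf\{n:\exists\, r \text{ such that }(\xi_n^r,\theta_n^r)\notin W\}$, $J=\min\{r:(\xi_N^r,\theta_N^r)\notin W\}$, $$f_{par}=\sum_{n=0}^{N-2}\sum_{r=1}^R\int_0^{\theta_n^r}f(\psi(t,\xi_n^r))\,dt+\sum_{r=1}^J\int_0^{\theta_{N-1}^r}f(\psi(t,\xi_{N-1}^r))\,dt,$$ and $(\xi_{par},\theta_{par})=(\xi_N^J,\theta_N^J)$. Then $$\mathbb E(f_{par})=\mathbb E\left(\sum_{n=0}^{M-1}\int_0^{\theta_n}f(\psi(t,\xi_n))\,dt\right)\qquad\text{and}\qquad(\xi_{par},\theta_{par})\stackrel{\mathcal L}{=}(\xi_M,\theta_M).$$ (ii) (Asynchronous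 parallel step.) Let $(t_{wall}^r(m)_{m\ge0})^{1\le r\le R}$ be nonnegative random numbers ($t_{wall}^r(m)$ being the wall-clock time it takes to compute the $r$th skeleton chain up to step $m$) such that: they are independent of $((\xi_n^r,\theta_n^r)_{n\ge0})^{1\le r\le R}$; almost surely, $t_{wall}^r(m)\le t_{wall}^r(n)$ when $m\le n$ and $1\le r\le R$; and almost surely there is a unique sequence $(r_k,m_k)_{k\ge1}$ with range $\{1,\ldots,R\}\times\{0,1,2,\ldots\}$ and $t_{wall}^{r_1}(m_1)<t_{wall}^{r_2}(m_2)<t_{wall}^{r_3}(m_3)<\cdots$. Let $\sigma^r=\inf\{m:(\xi_m^r,\theta_m^r)\notin W\}$, $K=\inf\{k:\sigma^{r_k}\le m_k+1\}$, $$f_{par}=\sum_{k=1}^K\int_0^{\theta_{m_k}^{r_k}}f(\psi(t,\xi_{m_k}^{r_k}))\,dt,\qquad(\xi_{par},\theta_{par})=(\xi_{\sigma^{r_K}}^{r_K},\theta_{\sigma^{r_K}}^{r_K}).$$ Then, again, $$\mathbb E(f_{par})=\mathbb E\left(\sum_{n=0}^{M-1}\int_0^{\theta_n}f(\psi(t,\xi_n))\,dt\right)\qquad\text{and}\qquad(\xi_{par},\theta_{par})\stackrel{\mathcal L}{=}(\xi_M,\theta_M).$$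
   Context: A PDMP in $\mathbb R^d$ is determined by a vector field $\Gamma$ with flow $\psi$, $\partial_t\psi(t,z)=\Gamma(\psi(t,z))$, $\psi(0,z)=z$; a jump rate $\lambda(z)\ge0$; and a Markov kernel $Q(z,dz')$. The PDMP is assumed to have a stationary distribution. Its skeleton chain $(\xi_n,\theta_n)_{n\ge0}$ is the time homogeneous Markov chain of pairs (position, holding time) with transitions: given $(\xi_n,\theta_n)$, $\xi_{n+1}$ is drawn from $Q(\psi(\theta_n,\xi_n),dz)$, and given $\xi_{n+1}$, $\theta_{n+1}$ is drawn with $\mathbb P(\theta_{n+1}>s)=\exp\left(-\int_0^s\lambda(\psi(u,\xi_{n+1}))\,du\right)$. Here $\xi_n$ is the position immediately after the $n$th jump ($\xi_0$ the initial position) and $\theta_n$ is the holding time before the next jump. A probability measure $\nu$ is a QSD of the chain in $W$ if $\nu(W)=1$ and, when $\mathcal L(\xi_0,\theta_0)=\nu$, $\mathbb P((\xi_n,\theta_n)\in A\mid M>n)=\nu(A)$ for all $n\ge0$ and measurable $A\subseteq W$, where $M=\inf\{n\ge0:(\xi_n,\theta_n)\notin W\}$. Standing assumption: the QSD $\nu$ in $W$ exists, is unique, and satisfies $\nu(A)=\lim_{n\to\infty}\mathbb P((\xi_n,\theta_n)\in A\mid(\xi_m,\theta_m)\in W,\ 0\le m\le n)$ for all measurable $A\subseteq W$ and any initial distribution supported in $W$. $\mathcal L$ denotes probability law and $\stackrel{\mathcal L}{=}$ equality in law. Empty sums are $0$ (e.g. $\sum_{n=0}^{N-2}$ when $N=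1$).
   Formalization: The equalities of expectations assume that the right-hand sum up to M-1 is integrable, or that the expected total of the positive (or of the negative) parts of its terms is finite; for bounded f alone the expectation may be undefined. The equalities in law are unconditional. *)

(* Defs.v *)
From HB Require Import structures.
From mathcomp Require Import all_boot all_order all_algebra.
From mathcomp Require Import all_classical all_reals all_analysis.

Set Implicit Arguments.
Unset Strict Implicit.
Unset Printing Implicit Defensive.

Import Order.TTheory GRing.Theory Num.Theory.
Import numFieldNormedType.Exports.

Local Open Scope classical_set_scope.
Local Open Scope ring_scope.

(* R^d with its Borel sigma-algebra *)
Definition borelRd (R : realType) (d : nat) : measurableType _ :=
  g_sigma_algebraType (@open 'rV[R]_d).

(* The derivative of the flow is taken along [0, +oo[, hence is one-sided at
   t = 0; the values of the flow at negative times are irrelevant.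
   [holding x] is the law of the time elapsed before the next jump when the
   process starts from x. It is determined by its survival function. Being a
   probability measure on R, it makes holding times finite, which the skeleton
   chain needs in order to be defined. The integrated rate is an extended real
   because the rate need not be locally integrable along the flow. *)
Record pdmp (R : realType) (d : nat) := Pdmp {
  drift : 'rV[R]_d -> 'rV[R]_d ;
  flow : R -> borelRd R d -> borelRd R d ;
  rate : borelRd R d -> R ;
  jump : R.-pker (borelRd R d) ~> (borelRd R d) ;
  holding : R.-pker (borelRd R d) ~> R ;
  flow0 : forall x, flow 0 x = x ;
  flowD : forall s t x, 0 <= s -> 0 <= t ->
    flow (s + t) x = flow t (flow s x) ;
  flow_derive : forall t x, 0 <= t ->
    h^-1 *: (flow (t + h) x - flow t x : 'rV[R]_d)
      @[h --> within [set h | 0 <= t + h] 0^'] --> drift (flow t x) ;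
  measurable_flow :
    measurable_fun setT (fun z : R * borelRd R d => flow z.1 z.2) ;
  rate_ge0 : forall x, 0 <= rate x ;
  measurable_rate : measurable_fun setT rate ;
  holdingE : forall x s, 0 <= s ->
    holding x [set` `]s, +oo[] =
    expeR (- \int[lebesgue_measure]_(u in `[0%R, s]) (rate (flow u x))%:E)%E }.

Section generated_sigma_algebras.
Context d (T : measurableType d) (R : realType) (P : probability T R).

Definition sigma_of (I : Type) (D : set I) d' (S : measurableType d')
    (X : I -> T -> S) : set (set T) :=
  <<s \bigcup_(i in D) preimage_set_system setT (X i) measurable >>.

Definition mutually_independent (I : finType) (F : I -> set (set T)) :=
  forall (J : {set I}) (A : I -> set T), (forall i, i \in J -> F i (A i)) ->
  P (\bigcap_(i in [set` J]) A i) = (\prod_(i in J) P (A i))%E.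

Definition independent2 (F G : set (set T)) :=
  forall A B, F A -> G B -> P (A `&` B) = (P A * P B)%E.

Definition has_law d' (S : measurableType d') (Z : T -> S)
    (m : set S -> \bar R) :=
  forall A, measurable A -> P (Z @^-1` A) = m A.

(* equals 0 when P B = 0 *)
Definition cond_prob (A B : set T) : R := fine (P (A `&` B)) / fine (P B).

End generated_sigma_algebras.

(* least element; 0 on the empty set *)
Definition first (S : set nat) : nat :=
  xget 0%N [set n | S n /\ forall m, S m -> (n <= m)%N].

Section skeleton.
Context (R : realType) (d : nat) (D : pdmp R d).

(* Elements are pairs (position, holding time); holding times are restricted to
   [0, +oo[ by requiring W to be a subset of [set z | 0 <= z.2]. *)
Definition chain_state := (borelRd R d * R)%type.

Definition skeleton_chain d' (T : measurableType d') (P : probability T R)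
    (X : nat -> T -> chain_state) :=
  (forall n, measurable_fun setT (X n)) /\
  (forall n F B, sigma_of [set k | (k <= n)%N] X F -> measurable B ->
    P (F `&` X n.+1 @^-1` B) =
    (\int[P]_(w in F) kproduct_snd (jump D) (holding D)
       (flow D (X n w).2 (X n w).1) B)%E).

Section paths.
Context d' (T : measurableType d') (X : nat -> T -> chain_state).

Definition jump_time (n : nat) (w : T) : R := \sum_(k < n) (X k w).2.

(* the event that the PDMP whose skeleton is X lies in A at time t *)
Definition pdmp_at (t : R) (A : set (borelRd R d)) : set T :=
  [set w | exists n, jump_time n w <= t < jump_time n.+1 w /\
    A (flow D (t - jump_time n w) (X n w).1)].

(* M; equals 0 when the chain never leaves W *)
Definition exit_time (W : set chain_state) (w : T) : nat :=
  first [set n | ~ W (X n w)].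

(* the event M > n *)
Definition survives (W : set chain_state) (n : nat) : set T :=
  [set w | forall m, (m <= n)%N -> W (X m w)].

Definition exit_state (W : set chain_state) (w : T) : chain_state :=
  X (exit_time W w) w.

Definition exit_sum (W : set chain_state) (g : chain_state -> R) (w : T) : R :=
  \sum_(n < exit_time W w) g (X n w).

End paths.

Definition has_stationary_distribution :=
  exists mu : probability (borelRd R d) R,
  forall d' (T : measurableType d') (P : probability T R)
    (X : nat -> T -> chain_state),
  skeleton_chain P X ->
  has_law P (X 0%N) (fun A => \int[mu]_x holding D x (xsection A x))%E ->
  forall t, 0 <= t -> forall A, measurable A -> P (pdmp_at X t A) = mu A.

Definition is_qsd (W : set chain_state) (nu : probability chain_state R) :=
  nu W = 1%E /\
  forall d' (T : measurableType d') (P : probability T R)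
    (X : nat -> T -> chain_state),
  skeleton_chain P X -> has_law P (X 0%N) nu ->
  forall n A, measurable A -> A `<=` W ->
  cond_prob P (X n @^-1` A) (survives X W n) = fine (nu A).

Definition qsd_unique (W : set chain_state) (nu : probability chain_state R) :=
  forall nu' : probability chain_state R, is_qsd W nu' ->
  forall A, measurable A -> nu' A = nu A.

Definition qsd_limit (W : set chain_state) (nu : probability chain_state R) :=
  forall d' (T : measurableType d') (P : probability T R)
    (X : nat -> T -> chain_state),
  skeleton_chain P X -> P (X 0%N @^-1` W) = 1%E ->
  forall A, measurable A -> A `<=` W ->
  cond_prob P (X n @^-1` A) (survives X W n) @[n --> \oo] --> fine (nu A).

Definition path_integral (f : borelRd R d -> R) (z : chain_state) : R :=
  \int[lebesgue_measure]_(t in `[0, z.2]) f (flow D t z.1).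

(* E(sum_(n < M) g (X_n)) is meaningful: the sum is integrable, or the expected
   total of the positive parts or that of the negative parts of the summands is
   finite. Boundedness of f alone does not exclude oo - oo when
   g = path_integral f, as holding times may have infinite mean. *)
Definition exit_sum_has_expectation (W : set chain_state)
    (g : chain_state -> R) d' (T : measurableType d') (P : probability T R)
    (X : nat -> T -> chain_state) :=
  [\/ P.-integrable setT (EFin \o exit_sum X W g),
      ('E_P[exit_sum X W g^\+%R] < +oo)%E |
      ('E_P[exit_sum X W g^\-%R] < +oo)%E].

(* The replicas are indexed by 'I_p.+1, i.e. R = p + 1 of them, numbered from
   0; ord0 below is only a default value. *)
Section parallel.
Context (p : nat) d' (T : measurableType d').
Context (Y : 'I_p.+1 -> nat -> T -> chain_state).
Context (W : set chain_state) (g : chain_state -> R).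

Definition sync_step (w : T) : nat :=
  first [set n | exists r, ~ W (Y r n w)].

Definition sync_index (w : T) : 'I_p.+1 :=
  [arg min_(r < ord0 | `[< ~ W (Y r (sync_step w) w) >]) (r : nat)]%N.

Definition sync_sum (w : T) : R :=
  \sum_(n < (sync_step w).-1) \sum_(r < p.+1) g (Y r n w) +
  \sum_(r < p.+1 | (r <= sync_index w)%N) g (Y r (sync_step w).-1 w).

Definition sync_state (w : T) : chain_state :=
  Y (sync_index w) (sync_step w) w.

(* s enumerates all pairs (replica, step) in increasing order of the wall-clock
   times; the sequence starts at index 0 instead of 1 *)
Definition wall_order (t : 'I_p.+1 -> nat -> R) (s : nat -> 'I_p.+1 * nat) :=
  (forall r m, exists k, s k = (r, m)) /\
  (forall k, t (s k).1 (s k).2 < t (s k.+1).1 (s k.+1).2).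

Context (tw : 'I_p.+1 -> nat -> T -> R).

Definition async_order (w : T) : nat -> 'I_p.+1 * nat :=
  xget (fun=> (ord0, 0%N)) [set s | wall_order (fun r m => tw r m w) s].

Definition async_step (w : T) : nat :=
  first [set k | (exit_time (Y (async_order w k).1) W w
                  <= (async_order w k).2.+1)%N].

(* the index k = 1, ..., K is shifted to k = 0, ..., async_step w *)
Definition async_sum (w : T) : R :=
  \sum_(k < (async_step w).+1)
    g (Y (async_order w k).1 (async_order w k).2 w).

Definition async_state (w : T) : chain_state :=
  exit_state (Y (async_order w (async_step w)).1) W w.

End parallel.

End skeleton.

(* Main.v *)
(* Quasi-stationarity makes the number of steps in W geometric: with a the one-step
   survival probability under nu, a chain started from nu satisfies
   P(M > n, X_n in B) = a^n nu(B) and P(M > n, X_(n+1) in B) = a^n kappa(B), where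
   kappa is the law of X_1. Now process the pairs (replica, step) one at a time, in
   an order that is independent of the chains and visits the steps of each replica
   successively, until a replica is seen to exit. When c_r steps of replica r have
   been processed and k = sum_r c_r, independence of the replicas gives
   prod_r a^(c_r) = a^k for the probability that no exit was seen, and the next
   pair is distributed as nu, whatever the order. Hence the expected total is
   sum_k a^k nu(g) and the law of the exit state is sum_k a^k kappa(. \ W), for
   every order. A single chain, the synchronous step (round robin) and the
   asynchronous step (wall-clock order) are three such orders. *)

Require Import Defs.
From HB Require Import structures.
From mathcomp Require Import all_boot all_order all_algebra.
From mathcomp Require Import all_classical all_reals all_analysis.
From mathcomp Require Import measurable_realfun lra.
Import Order.TTheory GRing.Theory Num.Theory.
Import numFieldNormedType.Exports.
Local Open Scope classical_set_scope.
Local Open Scope ring_scope.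

Set Implicit Arguments.
Unset Strict Implicit.
Unset Printing Implicit Defensive.

(** * Measurability and laws *)

(** A random order of processing is handled without conditional expectations: at stage [k] only its
    first values matter, they range over a countable set, and on each atom of this [history] the
    order is a fixed sequence. A schedule must therefore be measurable, almost surely sequential,
    and have histories independent of the replicas.

    Times and indices take default values on outcomes without exit, so each of the three sums agrees
    with a scheduled sum only almost surely, and its measurability is proved separately.

    The path integral is signed and may fail to be [nu]-integrable, so the totals of its positive
    and negative parts are kept apart and oo - oo has to be excluded. When only the exit sum is
    known to be integrable, cancellation inside it could hide two infinite totals. Ruling this out
    takes the law of the whole path shifted by one step, whereas marginal laws on survival events
    suffice elsewhere. *)

Section countable_measurability.
Context d (T : measurableType d).

Lemma measurable_setex (I : countType) (Q : I -> T -> Prop) :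
  (forall i, measurable [set w | Q i w]) -> measurable [set w | exists i, Q i w].
Proof.
move=> mQ; rewrite (_ : [set _ | _] = \bigcup_i [set w | Q i w]).
  by apply: countable_bigcupT_measurable.
by apply/seteqP; split=> w [i]; [move=> Qi; exists i | move=> _ Qi; exists i].
Qed.

Lemma measurable_setnot (Q : T -> Prop) :
  measurable [set w | Q w] -> measurable [set w | ~ Q w].
Proof. exact: measurableC. Qed.

Lemma measurable_setall (I : countType) (Q : I -> T -> Prop) :
  (forall i, measurable [set w | Q i w]) -> measurable [set w | forall i, Q i w].
Proof.
move=> mQ; rewrite (_ : [set _ | _] = [set w | ~ exists i, ~ Q i w]).
  by apply/measurable_setnot/measurable_setex => i; exact: measurable_setnot.
apply/seteqP; split=> w /= => [Qw [i]|nQ i]; first exact.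
by apply: contrapT => nQi; apply: nQ; exists i.
Qed.

Lemma measurable_setand (Q Q' : T -> Prop) :
  measurable [set w | Q w] -> measurable [set w | Q' w] ->
  measurable [set w | Q w /\ Q' w].
Proof. exact: measurableI. Qed.

Lemma measurable_setimp (Q Q' : T -> Prop) :
  measurable [set w | Q w] -> measurable [set w | Q' w] ->
  measurable [set w | Q w -> Q' w].
Proof.
move=> mQ mQ'; rewrite (_ : [set _ | _] = ~` [set w | Q w] `|` [set w | Q' w]).
  by apply: measurableU => //; exact: measurableC.
apply/seteqP; split=> w /= => [QQ'|[//|//]].
by have [Qw|nQ] := pselect (Q w); [right; exact: QQ'|left].
Qed.

Lemma measurable_setprop (Q : Prop) : measurable [set _ : T | Q].
Proof.
have [q|nq] := pselect Q.
  rewrite (_ : [set _ | _] = setT); first exact: measurableT.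
  by apply/seteqP; split.
rewrite (_ : [set _ | _] = set0); first exact: measurable0.
by apply/seteqP; split.
Qed.

(** The random times, replica indices and processed pairs below take countably many values, so
    evaluation at them reduces to a countable union over these values. *)
Lemma measurable_set_index (I : countType) (idx : T -> I) (Q : I -> T -> Prop) :
  (forall i, measurable [set w | idx w = i]) ->
  (forall i, measurable [set w | Q i w]) -> measurable [set w | Q (idx w) w].
Proof.
move=> mi mQ.
rewrite (_ : [set _ | _] = [set w | exists i, idx w = i /\ Q i w]).
  by apply: measurable_setex => i; apply: measurable_setand.
by apply/seteqP; split=> w /=; [exists (idx w)|move=> [_ [<-]]].
Qed.

Lemma measurable_fun_index d' (S : measurableType d') (I : countType)
    (idx : T -> I) (F : I -> T -> S) :
  (forall i, measurable [set w | idx w = i]) ->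
  (forall i, measurable_fun setT (F i)) ->
  measurable_fun setT (fun w => F (idx w) w).
Proof.
move=> mi mF _ B mB; rewrite setTI.
apply: (measurable_set_index (Q := fun i w => B (F i w))) => // i.
by rewrite -[X in measurable X]setTI; exact: mF.
Qed.

Lemma measurable_preim d' (S : measurableType d') (Z : T -> S) (B : set S) :
  measurable_fun setT Z -> measurable B -> measurable [set w | B (Z w)].
Proof. by move=> mZ mB; rewrite -[X in measurable X]setTI; exact: mZ. Qed.

Lemma measurable_set_ler (R : realType) (u v : T -> R) :
  measurable_fun setT u -> measurable_fun setT v ->
  measurable [set w | u w <= v w].
Proof.
move=> mu mv; rewrite (_ : [set _ | _] = setT `&` (fun w => u w <= v w) @^-1` [set true]).
  exact: measurable_fun_ler.
by rewrite setTI; apply/seteqP; split=> w /=; [move=> ->|move=> ->].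
Qed.

End countable_measurability.

(** The second alternative is the default value on the empty set. With both alternatives,
    [first S = n] is a countable Boolean combination of memberships in [S], which yields
    [measurable_first]. *)
Lemma first_eq (S : set nat) (n : nat) :
  first S = n <->
  (S n /\ forall m, S m -> (n <= m)%N) \/ ((forall m, ~ S m) /\ n = 0%N).
Proof.
rewrite /first; case: xgetP => [k kE [Sk minS]|noS]; split.
- by move=> <-; left.
- case=> [[Sn nS]|[nS _]]; last by case: (nS k).
  by apply/eqP; rewrite eqn_leq minS// nS.
- move=> <-; right; split=> // m Sm.
  have [k /= Sk minS] := ex_minnP (P := fun n => `[< S n >]) (ex_intro _ m (asboolT Sm)).
  by apply: (noS k); split=> [|i Si]; [exact/asboolP|exact/minS/asboolP].
- case=> [Sn|[_ ->//]]; by case: (noS n).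
Qed.

Lemma firstP (S : set nat) n : S n -> S (first S) /\ (first S <= n)%N.
Proof.
move=> Sn; have /first_eq[[? minS]|[nS _]] := erefl (first S).
  by split=> //; exact: minS.
by case: (nS n).
Qed.

Lemma first_min (S : set nat) n : (n < first S)%N -> ~ S n.
Proof. by move=> nS /firstP[_]; rewrite leqNgt nS. Qed.

Lemma measurable_first d (T : measurableType d) (S : T -> set nat) n :
  (forall k, measurable [set w | S w k]) -> measurable [set w | first (S w) = n].
Proof.
move=> mS; rewrite (_ : [set _ | _] =
    [set w | S w n /\ forall m, S w m -> (n <= m)%N] `|`
    [set w | (forall m, ~ S w m) /\ n = 0%N]).
  apply: measurableU; apply: measurable_setand => //.
  - apply: measurable_setall => m; apply: measurable_setimp => //.
    exact: measurable_setprop.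
  - by apply: measurable_setall => m; exact: measurable_setnot.
  - exact: measurable_setprop.
by apply/seteqP; split=> w /=; rewrite first_eq.
Qed.

Section laws.
Context d (T : measurableType d) (R : realType).

Lemma ae_eq_measure (P : {measure set T -> \bar R}) (A B : set T) :
  measurable A -> measurable B -> {ae P, forall w, A w <-> B w} -> P A = P B.
Proof.
move=> mA mB [N [mN N0 AB]].
have key (C D : set T) : measurable C -> measurable D ->
    (forall w, ~ N w -> C w -> D w) -> (P C <= P D)%E.
  move=> mC mD CD; rewrite -(measureU0 mD mN N0).
  apply: le_measure; rewrite ?inE//; first exact: measurableU.
  by move=> w Cw; have [?|?] := pselect (N w); [right|left; exact: CD].
have NAB w : ~ N w -> (A w <-> B w) by move=> Nw; apply: contrapT => /AB.
by apply/eqP; rewrite eq_le !key// => w /NAB [].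
Qed.

(** The hypothesis compares two image measures: that of [P] restricted to [F] under [Z], and [c]
    times that of [Q] restricted to [F'] under [Z']. Integrating [h] against both transfers
    quasi-stationarity from events to expectations. *)
Lemma ge0_integral_eq_law (P : {measure set T -> \bar R})
    d' (T' : measurableType d') (Q : {measure set T' -> \bar R})
    d'' (S : measurableType d'') (Z : T -> S) (Z' : T' -> S)
    (F : set T) (F' : set T') (c : R) (h : S -> \bar R) :
  measurable_fun setT Z -> measurable_fun setT Z' ->
  measurable F -> measurable F' -> 0 <= c ->
  (forall B, measurable B ->
     P (F `&` Z @^-1` B) = (c%:E * Q (F' `&` Z' @^-1` B))%E) ->
  measurable_fun setT h -> (forall x, 0 <= h x)%E ->
  (\int[P]_(w in F) h (Z w) = c%:E * \int[Q]_(w in F') h (Z' w))%E.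
Proof.
move=> mZ mZ' mF mF' c0 law mh h0.
have restr d1 (U : measurableType d1) (m : {measure set U -> \bar R})
    (G : set U) (mG : measurable G) (k : U -> \bar R) :
    measurable_fun setT k -> (forall x, 0 <= k x)%E ->
    (\int[m]_(w in G) k w = \int[mrestr m mG]_w k w)%E.
  move=> mk k0.
  have mGC := measurableC mG.
  rewrite -(setUv G) ge0_integral_setU ?setUv//; last exact/disj_setPCl.
  rewrite [X in (_ + X)%E]null_set_integral ?adde0.
  - apply: eq_measure_integral => A mA AG /=.
    by rewrite /mrestr; congr (m _); apply/esym/setIidl.
  - exact: measurableC.
  - exact: measurable_funTS.
  - by rewrite /= /mrestr setICl measure0.
have push d1 (U : measurableType d1) (m : {measure set U -> \bar R})
    (X : U -> S) (mX : measurable_fun setT X) :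
    (\int[m]_w h (X w) = \int[pushforward m X]_x h x)%E.
  by rewrite ge0_integral_pushforward.
rewrite (restr _ _ P _ mF (h \o Z)) ?(restr _ _ Q _ mF' (h \o Z'))//=; last 2 first.
- exact: measurableT_comp.
- exact: measurableT_comp.
rewrite (push _ _ _ _ mZ) (push _ _ _ _ mZ').
rewrite -[X in X%:E]/((NngNum c0)%:num) -ge0_integral_mscale//.
apply: eq_measure_integral => // A mA _.
by rewrite /= /mscale /pushforward /mrestr/= setIC law// setIC.
Qed.

(** Total probability over the atoms of [idx], on all of which [E] has the same conditional
    probability. The atoms are numbered through [pickle]; numbers that are not codes of values give
    empty sets. *)
Lemma measure_index (P : probability T R) (I : countType) (idx : T -> I)
    (E : set T) (c : R) :
  (forall i, measurable [set w | idx w = i]) -> measurable E -> 0 <= c ->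
  (forall i, P ([set w | idx w = i] `&` E) = (c%:E * P [set w | idx w = i])%E) ->
  P E = c%:E.
Proof.
move=> mi mE c0 PE.
pose F n := [set w | pickle (idx w) = n].
have FE n : (exists i, F n = [set w | idx w = i]) \/ F n = set0.
  have [[w /= wn]|nw] := pselect (exists w, pickle (idx w) = n).
    left; exists (idx w); apply/seteqP; split=> w' /=; rewrite /F/= -wn.
      exact: (pcan_inj pickleK).
    by move=> ->.
  by right; apply/seteqP; split=> // w' ?; case: nw; exists w'.
have mF n : measurable (F n) by case: (FE n) => [[i ->]|->].
have tF (G : set T) : trivIset setT (fun n => F n `&` G).
  by move=> n m _ _ [w [[<- _] [<- _]]].
have cover G : measurable G -> P G = (\sum_(n <oo) P (F n `&` G))%E.
  move=> mG; rewrite -measure_semi_bigcup//.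
  - by congr (P _); rewrite -setI_bigcupl; apply/seteqP; split=> [w Gw|w []//]; split=> //; exists (pickle (idx w)).
  - by move=> n; exact: measurableI.
  - by apply: bigcupT_measurable => n; exact: measurableI.
rewrite (cover E)//.
transitivity (\sum_(n <oo) c%:E * P (F n `&` setT))%E.
  apply: eq_eseriesr => n _; rewrite setIT.
  by case: (FE n) => [[i ->]|->]; [exact: PE|rewrite set0I !measure0 mule0].
by rewrite nneseriesZl// -cover// probability_setT mule1.
Qed.

End laws.

Section generated.
Context d (T : measurableType d) d' (S : measurableType d') (I : Type).
Variables (J : set I) (X : I -> T -> S).

(** The same outcomes with [sigma_of J X] as measurable sets: a measurability lemma instantiated at
    this type proves that an event belongs to [sigma_of J X]. *)
Definition sigma_ofType :=
  g_sigma_algebraType (\bigcup_(i in J) preimage_set_system setT (X i) measurable).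

Lemma sigma_of_coord i : J i -> measurable_fun setT (X i : sigma_ofType -> S).
Proof.
by move=> Ji _ B mB; apply: sub_sigma_algebra; exists i => //; exists B.
Qed.

Lemma sigma_of_sub (B : set T) : (forall i, J i -> measurable_fun setT (X i)) ->
  sigma_of J X B -> measurable B.
Proof.
move=> mX; apply: smallest_sub => [|A [i Ji [C mC <-]]]; last exact: mX.
exact: sigma_algebra_measurable.
Qed.

End generated.

Lemma sigma_ofS d (T : measurableType d) d' (S : measurableType d')
    (I I' : Type) (J : set I) (J' : set I') (X : I -> T -> S) (X' : I' -> T -> S) :
  (forall i, J i -> exists2 i', J' i' & X i = X' i') ->
  sigma_of J X `<=` sigma_of J' X'.
Proof.
move=> JJ'; apply: sub_sigma_algebra2 => A [i /JJ'[i' Ji' ->] XA].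
by exists i'.
Qed.

Section path_measurability.
Context (R : realType) (d : nat) (W : set (chain_state R d)).
Context d' (T : measurableType d') (X : nat -> T -> chain_state R d).
Hypothesis mW : measurable W.

(** Measurability is asked only of the coordinates up to [n], so that the lemma also applies over
    the sigma-algebra which they generate, as in [survives_sigma_of]. *)
Lemma measurable_survives n :
  (forall m, (m <= n)%N -> measurable_fun setT (X m)) ->
  measurable (survives X W n).
Proof.
move=> mX; apply: measurable_setall => m.
have [mn|mn] := boolP (m <= n)%N.
  by apply: measurable_setimp; [exact: measurable_setprop|apply: measurable_preim; [exact: mX|]].
by rewrite (_ : [set _ | _] = setT)//; apply/seteqP; split.
Qed.

Hypothesis mX : forall n, measurable_fun setT (X n).

Lemma measurable_exit_time n : measurable [set w | exit_time X W w = n].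
Proof.
apply: measurable_first => k.
by apply: (measurable_setnot (Q := fun w => W (X k w))); exact: measurable_preim.
Qed.

Lemma measurable_exit_state : measurable_fun setT (exit_state X W).
Proof. exact: (measurable_fun_index measurable_exit_time). Qed.

Lemma measurable_exit_sum (g : chain_state R d -> R) :
  measurable_fun setT g -> measurable_fun setT (exit_sum X W g).
Proof.
move=> mg; apply: (measurable_fun_index (F := fun k w => \sum_(n < k) g (X n w))
  measurable_exit_time) => k.
by apply: measurable_sum => i; exact: measurableT_comp.
Qed.

End path_measurability.

Section pdmp_measurability.
Context (R : realType) (d : nat) (D : pdmp R d).
Local Open Scope ereal_scope.

Definition skeleton_kernel (z : chain_state R d) (B : set (chain_state R d)) :=
  kproduct_snd (jump D) (holding D) (flow D z.2 z.1) B.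

Lemma measurable_skeleton_kernel B : measurable B ->
  measurable_fun setT (skeleton_kernel ^~ B).
Proof.
move=> mB.
pose h (y : borelRd R d) := \int[holding D y]_z (\1_B (y, z))%:E.
have mh : measurable_fun setT h.
  apply: (@measurable_kfcomp _ _ _ _ _ (holding D) (fun yz => (\1_B yz)%:E)) => //.
  by apply/measurable_EFinP; exact: measurable_indic.
have mk : measurable_fun setT (fun x => \int[jump D x]_y h y).
  apply: (@measurable_kfcomp _ _ _ _ _ (jump D) (fun xy => h xy.2)).
    by apply: (measurableT_comp mh); exact: measurable_snd.
  by move=> t; apply: integral_ge0 => y _; rewrite lee_fin.
have mf : measurable_fun setT (fun z : chain_state R d => flow D z.2 z.1).
  apply: (measurableT_comp (measurable_flow D) (g := fun z => (z.2, z.1))).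
  apply/measurable_fun_pairP; split; [exact: measurable_snd|exact: measurable_fst].
exact: (measurableT_comp mk mf).
Qed.

Lemma skeleton_kernel_ge0 z B : 0 <= skeleton_kernel z B.
Proof.
apply: integral_ge0 => y _; apply: integral_ge0 => ? _ /=.
by rewrite lee_fin.
Qed.

(** The bounds of integration move into the indicator of [A], which leaves one jointly measurable
    integrand. Tonelli's theorem applies to its positive and negative parts, and the path integral
    is [fine] of their difference. *)
Lemma measurable_path_integral (f : borelRd R d -> R) :
  measurable_fun setT f -> measurable_fun setT (path_integral D f).
Proof.
move=> mf.
pose A := [set tz : R * chain_state R d | 0 <= tz.1 /\ tz.1 <= tz.2.2]%R.
pose F (tz : R * chain_state R d) := (\1_A tz * f (flow D tz.1 tz.2.1))%R.
have mF : measurable_fun setT F.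
  apply: measurable_funM.
    apply: measurable_indic; apply: measurable_setand; apply: measurable_set_ler => //.
    exact: measurableT_comp.
  apply: (measurableT_comp mf).
  apply: (measurableT_comp (measurable_flow D) (g := fun tz => (tz.1, tz.2.1))).
  apply/measurable_fun_pairP; split; first exact: measurable_fst.
  exact: (measurableT_comp measurable_fst measurable_snd).
have mEF : measurable_fun setT (EFin \o F) by exact/measurable_EFinP.
rewrite (_ : path_integral D f = fun z => fine (
    fubini_G lebesgue_measure (EFin \o F)^\+ z - fubini_G lebesgue_measure (EFin \o F)^\- z)).
  apply: (@measurableT_comp _ _ _ _ _ _ fine) => //.
  by apply: emeasurable_funB; apply: measurable_fun_fubini_tonelli_G => //;
    [exact: measurable_funepos|exact: measurable_funeneg].
apply/funext => z; rewrite /path_integral /Rintegral integral_mkcond integralE.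
rewrite (_ : _ \_ _ = fun t => (EFin \o F) (t, z)).
  by rewrite /fubini_G; congr (fine (_ - _)); apply: eq_integral => t _; rewrite ?funeposE ?funenegE.
apply/funext => t; rewrite patchE /F /= indicE.
have -> : (t \in [set` `[0%R, z.2]]) = ((t, z) \in A).
  by apply/idP/idP; rewrite !inE /A/= in_itv/= => /andP.
by case: ifP => _; rewrite ?mul1r ?mul0r.
Qed.

End pdmp_measurability.

(** * Quasi-stationary chains *)

Section geometric_negligible.
Context d (T : measurableType d) (R : realType) (P : probability T R).

Lemma negligible_geometric (F : nat -> set T) (a : R) : 0 <= a < 1 ->
  (forall n, measurable (F n)) -> (forall n, P (F n) = (a ^+ n)%:E) ->
  P.-negligible (\bigcap_n F n).
Proof.
move=> /andP[a0 a1] mF PF.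
have mcap : measurable (\bigcap_n F n) by exact: bigcapT_measurable.
apply/negligibleP => //; apply/eqP; rewrite eq_le measure_ge0 andbT.
have cv : ((a ^+ n)%:E @[n --> \oo] --> 0)%E.
  apply: cvg_EFin; first exact: nearW.
  by apply: cvg_expr; rewrite ger0_norm.
rewrite -(cvg_lim _ cv)//; apply: lime_ge; first by apply/cvg_ex; exists 0%E.
apply: nearW => n; rewrite -PF; apply: le_measure; rewrite ?inE//.
exact: bigcap_inf.
Qed.

End geometric_negligible.

Section qsd.
Context (R : realType) (d : nat) (D : pdmp R d).
Context (W : set (chain_state R d)) (nu : probability (chain_state R d) R).
Hypotheses (mW : measurable W) (nu_qsd : is_qsd D W nu).
Local Open Scope ereal_scope.

(** This is the kappa of the overview. It is built from [nu] and the kernel without reference to a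
    chain, so that [X] and all replicas share it, and with it the survival rate. *)
Definition next_law (B : set (chain_state R d)) : \bar R :=
  \int[nu]_z skeleton_kernel D z B.

Definition survival_rate : R := fine (next_law W).

Context d' (T : measurableType d') (P : probability T R).
Context (X : nat -> T -> chain_state R d).
Hypotheses (X_chain : skeleton_chain D P X) (X_law : has_law P (X 0%N) nu).

Let mX n : measurable_fun setT (X n) := X_chain.1 n.

Let mS n : measurable (survives X W n).
Proof. exact: measurable_survives. Qed.

Lemma survives_sigma_of n : sigma_of [set k | (k <= n)%N] X (survives X W n).
Proof.
apply: (@measurable_survives _ _ _ _ (sigma_ofType [set k | (k <= n)%N] X)) => // m mn.
exact: sigma_of_coord.
Qed.

Lemma nu_setIW B : measurable B -> nu (B `&` W) = nu B.
Proof.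
move=> mB; apply: ae_eq_measure => //; first exact: measurableI.
exists (~` W); split; first exact: measurableC.
  by rewrite [LHS]probability_setC// nu_qsd.1 subee.
by move=> w /= nBW Ww; apply: nBW; split=> [[]|].
Qed.

(** Since [cond_prob] is a quotient, a null survival event, for which both sides vanish, is treated
    apart. The QSD property concerns subsets of [W]; intersecting [B] with [W] changes neither side,
    as survival forces [X n] into [W] and [nu] is carried by [W]. *)
Lemma qsd_survives n B : measurable B ->
  P (survives X W n `&` X n @^-1` B) = (fine (P (survives X W n)))%:E * nu B.
Proof.
move=> mB.
have mXB (C : set (chain_state R d)) : measurable C -> measurable (X n @^-1` C).
  by move=> mC; exact: measurable_preim.
have [S0|S0] := eqVneq (P (survives X W n)) 0.
  rewrite S0 mul0e; apply: (subset_measure0 _ _ _ S0) => //.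
  by apply: measurableI => //; exact: mXB.
have mBW : measurable (B `&` W) by exact: measurableI.
have fS : P (survives X W n) \is a fin_num by exact: fin_num_measure.
have qE := nu_qsd.2 _ _ _ _ X_chain X_law n _ mBW (@subIsetr _ _ _).
have {}qE : fine (P (X n @^-1` (B `&` W) `&` survives X W n)) =
    (fine (P (survives X W n)) * fine (nu (B `&` W)))%R.
  rewrite -qE /cond_prob mulrC divfK//.
  by rewrite fine_eq0.
have := congr1 EFin qE; rewrite {qE} EFinM fineK; last first.
  by rewrite fin_num_measure//; apply: measurableI => //; exact: mXB.
rewrite nu_setIW//.
rewrite [X in _ = _ * X]fineK ?fin_num_measure// => <-.
congr (P _); apply/seteqP; split=> w [].
  by move=> Sw Bw; split=> //; split=> //; exact: Sw.
by move=> [Bw _] Sw.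
Qed.

(** The Markov property integrates the kernel over the survival event, on which [X n] has law [nu]
    up to a constant factor. *)
Lemma step_survives n B : measurable B ->
  P (survives X W n `&` X n.+1 @^-1` B) =
  (fine (P (survives X W n)))%:E * next_law B.
Proof.
move=> mB; rewrite X_chain.2//; last exact: survives_sigma_of.
rewrite [LHS](ge0_integral_eq_law (Q := nu) (Z' := id) (F' := setT)
  (c := fine (P (survives X W n)))
  (h := skeleton_kernel D ^~ B))//.
- exact: fine_ge0.
- by move=> A mA; rewrite setTI; exact: qsd_survives.
- exact: measurable_skeleton_kernel.
- by move=> z; exact: skeleton_kernel_ge0.
Qed.

Lemma survives0 : P (survives X W 0) = 1.
Proof.
rewrite (_ : survives X W 0 = X 0%N @^-1` W) ?X_law ?nu_qsd.1//.
apply/seteqP; split=> w /=; first by move=> /(_ 0%N); exact.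
by move=> Ww m; rewrite leqn0 => /eqP ->.
Qed.

Lemma next_lawE B : measurable B -> next_law B = P (survives X W 0 `&` X 1%N @^-1` B).
Proof. by move=> mB; rewrite step_survives// survives0 mul1e. Qed.

Lemma survivesS n : survives X W n.+1 = survives X W n `&` X n.+1 @^-1` W.
Proof.
apply/seteqP; split=> w /=.
  by move=> Sw; split=> [m mn|]; apply: Sw => //; exact: leqW.
move=> [Sw Ww] m; rewrite leq_eqVlt ltnS => /predU1P[->//|]; exact: Sw.
Qed.

Lemma next_law_fin_num B : measurable B -> next_law B \is a fin_num.
Proof.
move=> mB; rewrite next_lawE// fin_num_measure//; apply: measurableI => //.
exact: measurable_preim.
Qed.

Lemma survival_rate_ge0 : (0 <= survival_rate)%R.
Proof. by apply: fine_ge0; apply: integral_ge0 => z _; exact: skeleton_kernel_ge0. Qed.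

Lemma prob_survives n : P (survives X W n) = (survival_rate ^+ n)%:E.
Proof.
elim: n => [|n IHn]; first exact: survives0.
rewrite survivesS step_survives// IHn/= exprSr EFinM fineK//.
exact: next_law_fin_num.
Qed.

Lemma law_survives n B : measurable B ->
  P (survives X W n `&` X n @^-1` B) = (survival_rate ^+ n)%:E * nu B.
Proof. by move=> mB; rewrite qsd_survives// prob_survives. Qed.

Lemma law_survives_next n B : measurable B ->
  P (survives X W n `&` X n.+1 @^-1` B) = (survival_rate ^+ n)%:E * next_law B.
Proof. by move=> mB; rewrite step_survives// prob_survives. Qed.

Lemma ae_start : {ae P, forall w, W (X 0%N w)}.
Proof.
exists (X 0%N @^-1` (~` W)); split=> //.
  by apply: measurable_preim => //; exact: measurableC.
rewrite X_law; last exact: measurableC.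
by rewrite [LHS]probability_setC// nu_qsd.1 subee.
Qed.

(** A rate of at least one would make every survival event almost sure. Together with the converse
    [ae_exit], this carries almost sure exit over from [X] to the replicas, which have the same
    rate. *)
Lemma survival_rate_lt1 : {ae P, forall w, exists n, ~ W (X n w)} ->
  (survival_rate < 1)%R.
Proof.
move=> X_exit; rewrite ltNge; apply/negP => ge1.
have surv1 n : P (~` survives X W n) = 0.
  apply/eqP; rewrite eq_le measure_ge0 andbT probability_setC// prob_survives.
  by rewrite sube_le0 lee_fin exprn_ege1.
have : P.-negligible setT.
  apply: negligibleS (negligibleU X_exit
    (negligible_bigcup (F := fun n => ~` survives X W n) _)).
  - move=> w _; have [[n nW]|] := pselect (exists n, ~ W (X n w)); last by left.
    by right; exists n => //= /(_ n (leqnn n)).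
  - by move=> k; apply/negligibleP; [exact: measurableC|exact: surv1].
move=> /(measure_negligible measurableT); rewrite [X in X = _]probability_setT => /eqP.
by rewrite onee_eq0.
Qed.

Lemma ae_exit : (survival_rate < 1)%R ->
  {ae P, forall w, exists n, ~ W (X n w)}.
Proof.
move=> lt1; have a01 : (0 <= survival_rate < 1)%R by rewrite survival_rate_ge0.
apply: negligibleS (negligible_geometric a01 mS prob_survives).
by move=> w /= nW n _ m _; apply: contrapT => nWm; apply: nW; exists m.
Qed.

End qsd.

(** * Schedules of replicas *)

Section replica_schedules.
Context (p : nat).
Implicit Types (u : nat -> 'I_p.+1 * nat) (r : 'I_p.+1).

Definition visits u r (k : nat) : nat := \sum_(j < k) ((u j).1 == r).

(* each replica is advanced one step at a time, starting from step 0 *)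
Definition sequential u := forall k, (u k).2 = visits u (u k).1 k.

Lemma visitsS u r k : visits u r k.+1 = (visits u r k + ((u k).1 == r))%N.
Proof. by rewrite /visits big_ord_recr. Qed.

Lemma sum_visits u k : (\sum_r visits u r k)%N = k.
Proof.
elim: k => [|k IHk]; first by rewrite big1// => r _; rewrite /visits big_ord0.
under eq_bigr do rewrite visitsS.
rewrite big_split/= IHk (bigD1 (u k).1)//= eqxx big1 ?addn0 ?addn1//.
by move=> r rk; rewrite eq_sym (negbTE rk).
Qed.

(** The processed steps of a replica form an initial segment. Sequentiality is assumed only before
    [k], so that the lemma can serve inside the strong induction of [sequential_enum]. *)
Lemma visitsP u k r m : (forall j, (j < k)%N -> (u j).2 = visits u (u j).1 j) ->
  (exists2 j, (j < k)%N & u j = (r, m)) <-> (m < visits u r k)%N.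
Proof.
elim: k => [|k IHk] useq; first by rewrite /visits big_ord0; split=> // -[].
have {}IHk := IHk (fun j jk => useq j (leqW jk)).
rewrite visitsS; split=> [[j]|].
  rewrite ltnS leq_eqVlt => /predU1P[-> urm|jk urm]; last first.
    by apply: ltn_addr; apply/IHk; exists j.
  by have := useq k (ltnSn k); rewrite urm/= => ->; rewrite eqxx addn1.
have [rk|rk] := eqVneq (u k).1 r; last first.
  by rewrite addn0 => /IHk[j jk urm]; exists j => //; exact: leqW.
rewrite addn1 ltnS leq_eqVlt => /predU1P[->|/IHk[j jk urm]]; last first.
  by exists j => //; exact: leqW.
exists k => //; rewrite -rk -useq//; exact: surjective_pairing.
Qed.

Lemma sequential_enum u : (forall r m, exists k, u k = (r, m)) ->
  (forall j k, u j = u k -> j = k) ->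
  (forall j k, (u j).1 = (u k).1 -> ((u j).2 < (u k).2)%N -> (j < k)%N) ->
  sequential u.
Proof.
move=> usurj uinj uinc k; elim/ltn_ind: k => k IHk.
set r := (u k).1; set m := (u k).2.
have ukE : u k = (r, m) by exact: surjective_pairing.
apply/eqP; rewrite eqn_leq; apply/andP; split; last first.
  (* A step below the number of visits was already processed, against injectivity. *)
  rewrite leqNgt; apply/negP => /(visitsP _ _ IHk)[j jk urm].
  by move: jk; rewrite (uinj j k) ?ltnn// urm ukE.
(* A step above it would skip step [visits u r k], which is enumerated somewhere, and by
   monotonicity before [k]. *)
rewrite leqNgt; apply/negP => vm.
have [j ujE] := usurj r (visits u r k).
have jk : (j < k)%N by apply: uinc; rewrite ujE.
have /(visitsP _ _ IHk) : exists2 j, (j < k)%N & u j = (r, visits u r k) by exists j.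
by rewrite ltnn.
Qed.

End replica_schedules.

Section scheduled_exploration.
Context (R : realType) (d p : nat) (W : set (chain_state R d)).
Hypothesis mW : measurable W.
Context d' (T : measurableType d') (P : probability T R).
Context (Y : 'I_p.+1 -> nat -> T -> chain_state R d).
Context (s : nat -> T -> 'I_p.+1 * nat).

(** Offset [0] is the state whose value under [g] is added at stage [k]; offset [1] is its
    successor, which is tested for exit. The parameter lets [law_current] treat [nu] and kappa at
    once. *)
Definition current (i k : nat) (w : T) : chain_state R d :=
  Y (s k w).1 ((s k w).2 + i)%N w.

Definition alive (k : nat) : set T :=
  [set w | forall j, (j < k)%N -> W (current 1 j w)].

Definition stop (w : T) : nat := first [set k | ~ W (current 1 k w)].

Definition scheduled_sum (g : chain_state R d -> R) (w : T) : R :=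
  \sum_(k < (stop w).+1) g (current 0 k w).

(** Its values lie in a countable type, which is what allows arguing atom by atom. *)
Definition history (k : nat) (w : T) : seq ('I_p.+1 * nat) :=
  mkseq (s ^~ w) k.

Hypothesis mY : forall r n, measurable_fun setT (Y r n).
Hypothesis ms : forall k x, measurable [set w | s k w = x].

Lemma measurable_history k q : measurable [set w | history k w = q].
Proof.
elim: k q => [|k IHk] q.
  by have := @measurable_setprop _ T ([::] = q).
case/lastP: q => [|q x].
  by rewrite (_ : [set _ | _] = set0)//; apply/seteqP; split=> // w /(congr1 size).
rewrite (_ : [set _ | _] = [set w | history k w = q /\ s k w = x]).
  exact: measurable_setand.
apply/seteqP; split=> w /=; rewrite /history mkseqS; first by move=> /rcons_inj[-> ->].
by move=> [-> ->].
Qed.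

Lemma measurable_current i k : measurable_fun setT (current i k).
Proof.
by apply: (measurable_fun_index (idx := s k) (F := fun x w => Y x.1 (x.2 + i)%N w)).
Qed.

Lemma measurable_alive k : measurable (alive k).
Proof.
apply: measurable_setall => j; apply: measurable_setimp.
  exact: measurable_setprop.
exact: measurable_preim (measurable_current 1 j) mW.
Qed.

Lemma measurable_stop n : measurable [set w | stop w = n].
Proof.
apply: measurable_first => k; apply: measurable_setnot.
exact: measurable_preim (measurable_current 1 k) mW.
Qed.

Lemma measurable_scheduled_sum g :
  measurable_fun setT g -> measurable_fun setT (scheduled_sum g).
Proof.
move=> mg; apply: (measurable_fun_index
  (F := fun n w => \sum_(k < n.+1) g (current 0 k w)) measurable_stop) => n.
by apply: measurable_sum => k; apply: measurableT_comp => //; exact: measurable_current.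
Qed.

Hypothesis s_seq : {ae P, forall w, sequential (s ^~ w)}.
Hypothesis s_indep : forall k q B, sigma_of setT (fun rn => Y rn.1 rn.2) B ->
  P ([set w | history k w = q] `&` B) = (P [set w | history k w = q] * P B)%E.
Hypothesis Y_indep : mutually_independent P (fun r => sigma_of setT (Y r)).
Hypothesis Y_start : forall r, {ae P, forall w, W (Y r 0%N w)}.
Context (a : R) (nu : probability (chain_state R d) R).
Hypothesis a01 : 0 <= a < 1.
Hypothesis Y_law : forall r n B, measurable B ->
  P (survives (Y r) W n `&` Y r n @^-1` B) = ((a ^+ n)%:E * nu B)%E.

Lemma prob_survives_replica r n : P (survives (Y r) W n) = (a ^+ n)%:E.
Proof. by rewrite -[X in P X]setIT -(preimage_setT (Y r n)) Y_law// probability_setT mule1. Qed.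

(* On an atom of [history k.+1] the pairs processed so far are fixed, so the event
   is an intersection of survival events of the independent replicas. *)
Lemma law_current i (m : set (chain_state R d) -> R) :
  (forall B, 0 <= m B) ->
  (forall r n B, measurable B ->
     P (survives (Y r) W n `&` Y r (n + i)%N @^-1` B) = (a ^+ n * m B)%:E) ->
  forall k B, measurable B ->
    P (alive k `&` current i k @^-1` B) = (a ^+ k * m B)%:E.
Proof.
move=> m0 Ym k B mB; have [a0 a1] := andP a01.
have mE : measurable (alive k `&` current i k @^-1` B).
  apply: measurableI; first exact: measurable_alive.
  exact: measurable_preim (measurable_current i k) mB.
(* The length is [k.+1] because the pair processed at stage [k] must be fixed too. *)
apply: (measure_index (@measurable_history k.+1)) => // [|q].
  by rewrite mulr_ge0// exprn_ge0.
set H := [set w | history k.+1 w = q].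
have mH : measurable H by exact: measurable_history.
(* An atom without a sequential outcome is null, and both sides vanish; otherwise one outcome
   supplies the sequence [u] for the whole atom. *)
have [[w0 [Hw0 seq0]]|nH] :=
  pselect (exists w0, H w0 /\ sequential (s ^~ w0)); last first.
  have PH (C : set T) : measurable C -> P (H `&` C) = 0%E.
    move=> mC; transitivity (P set0); last exact: measure0.
    apply: ae_eq_measure => //; first exact: measurableI.
    apply: filterS s_seq => w seqw; split=> // -[Hw _]; apply: nH.
    by exists w.
  by rewrite PH// -[H]setIT PH// mule0.
have [u useq Hu] : exists2 u, sequential u &
    forall w, H w -> forall j, (j <= k)%N -> s j w = u j.
  exists (s ^~ w0) => // w Hw j jk.
  rewrite -(nth_mkseq (s k w) (s ^~ w) (n := k.+1))//.
  by rewrite -[mkseq _ _]/(history k.+1 w) Hw -Hw0 nth_mkseq.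
set r0 := (u k).1.
(* The processed pairs of [r] test its steps from 1 to [visits u r k]; step 0 is added by [Y_start].
   The pair of stage [k] sits at exactly this step of [r0]. *)
pose A r := survives (Y r) W (visits u r k) `&`
  (if r == r0 then Y r (visits u r k + i)%N @^-1` B else setT).
have sA r : sigma_of setT (Y r) (A r).
  have mYr n : measurable_fun setT (Y r n : sigma_ofType setT (Y r) -> _).
    exact: sigma_of_coord.
  apply: (@measurableI _ (sigma_ofType setT (Y r))).
    exact: (measurable_survives (T := sigma_ofType setT (Y r))).
  by case: ifP => _; [exact: (measurable_preim (mYr _))|exact: measurableT].
pose G := \bigcap_(r in [set` [set: 'I_p.+1]%SET]) A r.
have sG : sigma_of setT (fun rn => Y rn.1 rn.2) G.
  apply: (@measurable_setall _ (sigma_ofType setT (fun rn => Y rn.1 rn.2))) => r.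
  apply: measurable_setimp; first exact: measurable_setprop.
  by apply: sigma_ofS (sA r) => n _; exists (r, n).
have mG : measurable G by apply: sigma_of_sub sG => -[r n] _ /=.
transitivity (P (H `&` G)).
  apply: ae_eq_measure => //; [exact: measurableI|exact: measurableI|].
  have : {ae P, forall w, forall r, W (Y r 0%N w)} by apply: filter_forall.
  apply: filterS => w Yw; split=> -[Hw Ew]; split=> //.
    case: Ew => al Bw r _; split=> [[//|n] nv|].
      have [j jk ujE] := (visitsP r n (fun j _ => useq j)).2 nv.
      by have := al _ jk; rewrite /current (Hu _ Hw _ (ltnW jk)) ujE/= addn1.
    case: eqP => // ->; move: Bw; rewrite /= /current (Hu _ Hw _ (leqnn k)) useq.
    exact.
  split=> [j jk|].
    have [+ _] := Ew (u j).1 (finset.in_setT _); rewrite /current (Hu _ Hw _ (ltnW jk)).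
    rewrite addn1; apply.
    by apply/(visitsP _ _ (fun j _ => useq j)); exists j => //; exact: surjective_pairing.
  have [_] := Ew r0 (finset.in_setT _); rewrite eqxx /= /current (Hu _ Hw _ (leqnn k)) useq.
  exact.
rewrite s_indep// muleC; congr (_ * _)%E.
rewrite /G Y_indep//.
have PA r : P (A r) = (a ^+ visits u r k * (if r == r0 then m B else 1))%:E.
  by rewrite /A; case: eqP => [->|_]; rewrite ?Ym ?setIT ?prob_survives_replica ?mulr1.
rewrite (eq_bigr _ (fun r _ => PA r)) prodEFin; congr EFin.
rewrite (eq_bigl xpredT); last by move=> r; rewrite inE.
(* The exponents add up to [k] whatever [u] is, and only [r0] contributes the factor [m B]. *)
rewrite big_split/= prodrXr sum_visits; congr (_ * _).
by rewrite (bigD1 r0)//= eqxx big1 ?mulr1// => r /negbTE ->.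
Qed.

Lemma law_current0 k B : measurable B ->
  P (alive k `&` current 0 k @^-1` B) = ((a ^+ k)%:E * nu B)%E.
Proof.
move=> mB; have nu_fin C : measurable C -> nu C \is a fin_num by move=> ?; exact: fin_num_measure.
rewrite (law_current (m := fun C => fine (nu C)))// => [|C|r n C mC].
- by rewrite EFinM fineK ?nu_fin.
- exact: fine_ge0.
- by rewrite addn0 Y_law// EFinM fineK ?nu_fin.
Qed.

Lemma prob_alive k : P (alive k) = (a ^+ k)%:E.
Proof.
by rewrite -[X in P X]setIT -(preimage_setT (current 0 k)) law_current0// probability_setT mule1.
Qed.

Lemma ae_stop : {ae P, forall w, exists k, ~ W (current 1 k w)}.
Proof.
apply: negligibleS (negligible_geometric a01 measurable_alive prob_alive).
by move=> w /= nW k _ j _; apply: contrapT => nWj; apply: nW; exists j.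
Qed.

Lemma stopP w : (exists k, ~ W (current 1 k w)) ->
  ~ W (current 1 (stop w) w) /\ forall k, alive k w <-> (k <= stop w)%N.
Proof.
move=> [k0 /(firstP (S := [set k | ~ W (current 1 k w)]))[stopW _]].
split=> // k; split=> [al|ks j jk].
  by rewrite leqNgt; apply/negP => /al.
by apply: contrapT => /(firstP (S := [set k | ~ W (current 1 k w)]))[_]; rewrite leqNgt (leq_trans jk).
Qed.

(** The event is split by the stage of the stop: stopping at [k] means being alive at [k] and
    finding a successor outside [W]. Removing [W] from [A] makes the pieces disjoint, since being
    alive later requires the earlier successors to lie in [W]. *)
Lemma law_stop (m : set (chain_state R d) -> R) A : (forall B, 0 <= m B) ->
  (forall r n B, measurable B ->
     P (survives (Y r) W n `&` Y r n.+1 @^-1` B) = (a ^+ n * m B)%:E) ->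
  measurable A ->
  P [set w | A (current 1 (stop w) w)] =
  (\sum_(k <oo) (a ^+ k * m (A `\` W))%:E)%E.
Proof.
move=> m0 Ym mA; have mAW : measurable (A `\` W) by exact: measurableD.
pose F k := alive k `&` current 1 k @^-1` (A `\` W).
have mF k : measurable (F k).
  apply: measurableI; first exact: measurable_alive.
  exact: measurable_preim (measurable_current 1 k) mAW.
have mUF : measurable (\bigcup_k F k) by exact: bigcupT_measurable.
transitivity (P (\bigcup_k F k)).
  apply: ae_eq_measure => //.
    apply: (measurable_set_index (Q := fun k w => A (current 1 k w)) measurable_stop) => k.
    exact: measurable_preim (measurable_current 1 k) mA.
  apply: filterS ae_stop => w /stopP[stopW aliveE]; split=> [Aw|].
    by exists (stop w) => //; split; [exact/aliveE|].
  move=> [k _ [/aliveE ks [Ak nWk]]].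
  suff kE : k = stop w by rewrite /= -kE.
  apply/eqP; rewrite eqn_leq ks /= leqNgt; apply/negP => sk.
  by have /(_ _ sk) := (aliveE _).2 (leqnn (stop w)).
rewrite measure_semi_bigcup//; last first.
  have lt i j w : F i w -> F j w -> ~ (i < j)%N.
    by move=> [_ [_ nW]] [al _] ij; apply: nW; exact: al.
  move=> i j _ _ [w [Fi Fj]].
  by case: (ltngtP i j) => // ij; exfalso; [exact: (lt i j w)|exact: (lt j i w)].
apply: eq_eseriesr => k _; apply: law_current => // r n B mB.
by rewrite addn1 Ym.
Qed.

(** Almost surely [alive k] says that [k] is at most the stop, so the random sum is the series of
    the terms cut off outside [alive k]; nonnegativity permits exchanging series and integral. *)
Lemma expectation_scheduled_sum (g : chain_state R d -> R) :
  measurable_fun setT g -> (forall z, 0 <= g z) ->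
  (\int[P]_w (scheduled_sum g w)%:E =
   \sum_(k <oo) (a ^+ k)%:E * \int[nu]_z (g z)%:E)%E.
Proof.
move=> mg g0.
pose F k : T -> \bar R := (fun w => (g (current 0 k w))%:E) \_ (alive k).
have mgc k : measurable_fun setT (fun w => (g (current 0 k w))%:E).
  apply/measurable_EFinP; apply: measurableT_comp => //; exact: measurable_current.
have mF k : measurable_fun setT (F k).
  apply/(measurable_restrictT _ (measurable_alive k)); exact: measurable_funTS.
have F0 k w : (0 <= F k w)%E by rewrite /F patchE; case: ifP => // _; rewrite lee_fin.
transitivity (\int[P]_w (\sum_(k <oo) F k w))%E.
  apply: ae_eq_integral => //.
  - by apply/measurable_EFinP; exact: measurable_scheduled_sum.
  - by apply: ge0_emeasurable_sum.
  apply: filterS ae_stop => w /stopP[_ aliveE] _.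
  apply/esym/cvg_lim => //; apply: cvg_near_cst; exists (stop w).+1 => // n /= sn.
  have tail : (\sum_((stop w).+1 <= k < n) F k w = 0)%E.
    rewrite big_nat_cond big1// => k /andP[/andP[sk _] _].
    by rewrite /F patchE memNset// => /aliveE; rewrite leqNgt sk.
  rewrite (big_cat_nat (n := (stop w).+1)) //= tail adde0 big_mkord /scheduled_sum -sumEFin.
  apply: eq_bigr => k _; rewrite /F patchE mem_set//.
  by apply/aliveE; rewrite -ltnS.
rewrite integral_nneseries//; apply: eq_eseriesr => k _.
rewrite -integral_mkcond.
rewrite (ge0_integral_eq_law (Z := current 0 k) (Q := nu) (Z' := id) (F' := setT) (c := a ^+ k)
  (h := EFin \o g))//.
- exact: measurable_current.
- exact: measurable_alive.
- by rewrite exprn_ge0//; case/andP: a01.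
- by move=> B mB; rewrite setTI; exact: law_current0.
- exact/measurable_EFinP.
Qed.

End scheduled_exploration.

Lemma forall_ltnS (Q : nat -> Prop) n :
  (forall i, (i < n.+1)%N -> Q i) <-> (forall i, (i < n)%N -> Q i) /\ Q n.
Proof.
split=> [Qn|[Qn Qnn] i]; first by split=> [i /ltnW ?|]; exact: Qn.
by rewrite ltnS leq_eqVlt => /predU1P[->|/Qn].
Qed.

(** * Integrable exit sums *)

Section path_law.
Context (R : realType) (d : nat) (D : pdmp R d).
Context (W : set (chain_state R d)) (nu : probability (chain_state R d) R).
Hypotheses (mW : measurable W) (nu_qsd : is_qsd D W nu).

Definition coordinate_sets : set (set (nat -> chain_state R d)) :=
  \bigcup_(n in [set: nat])
    preimage_set_system setT (fun x : nat -> chain_state R d => x n) measurable.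

(** Trajectories carry the product sigma-algebra. The exit sum is a measurable function of the
    trajectory, so an identity of laws on this space passes to integrals of the exit sum. *)
Definition path_space := g_sigma_algebraType coordinate_sets.

Lemma measurable_coord n : measurable_fun setT (fun x : path_space => x n).
Proof. by move=> _ B mB; apply: sub_sigma_algebra; exists n => //; exists B. Qed.

Definition cylinder : set (set path_space) :=
  [set Z | exists n (A : nat -> set (chain_state R d)),
    (forall i, measurable (A i)) /\
    Z = [set x | forall i, (i < n)%N -> A i (x i)]].

Lemma cylinder_generates E : measurable E -> (<<s cylinder >>) E.
Proof.
apply: sub_sigma_algebra2 => _ [n _ [B mB <-]].
exists n.+1, (fun i => if i == n then B else setT); split.
  by move=> i; case: ifP.
rewrite setTI; apply/seteqP; split=> x /= => [Bx i _|/(_ n (ltnSn n))].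
  by case: eqP => [->|].
by rewrite eqxx.
Qed.

Lemma measurable_cylinder E : cylinder E -> measurable E.
Proof.
move=> [n [A [mA ->]]]; apply: measurable_setall => i; apply: measurable_setimp.
  exact: measurable_setprop.
exact: measurable_preim (measurable_coord i) (mA i).
Qed.

Lemma cylinderI : setI_closed cylinder.
Proof.
move=> _ _ [n [A [mA ->]]] [m [B [mB ->]]].
exists (maxn n m), (fun i => (if (i < n)%N then A i else setT) `&`
                             (if (i < m)%N then B i else setT)); split.
  by move=> i; apply: measurableI; case: ifP.
apply/seteqP; split=> x /= => [[Ax Bx] i _|AB].
  by split; case: ifPn => // ?; [exact: Ax|exact: Bx].
split=> i im; have /AB : (i < maxn n m)%N by rewrite leq_max im ?orbT.
  by rewrite im => -[].
by rewrite im => -[].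
Qed.

Context d' (T : measurableType d') (P : probability T R).
Context (X : nat -> T -> chain_state R d).
Hypotheses (X_chain : skeleton_chain D P X) (X_law : has_law P (X 0%N) nu).

Let mX n : measurable_fun setT (X n) := X_chain.1 n.
Let a := survival_rate D W nu.

Definition path_from (k : nat) (w : T) : path_space := fun n => X (k + n)%N w.

Lemma measurable_path_from k : measurable_fun setT (path_from k).
Proof.
apply: (@measurability _ _ T path_space _ _ coordinate_sets) => //.
move=> _ [_ [n _ [B mB <-]] <-]; rewrite !setTI.
exact: measurable_preim (mX (k + n)) mB.
Qed.

(** Induction with the last set [B] kept apart: the Markov property integrates out the last
    coordinate, and the constraint [A n] is absorbed into the last set one step earlier. The base
    case is quasi-stationarity at step 1. *)
Lemma cylinder_shift n (A : nat -> set (chain_state R d)) B :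
  (forall i, measurable (A i)) -> measurable B ->
  (P ((survives X W 1 `&` [set w | forall i, (i < n)%N -> A i (X i.+1 w)]) `&`
      X n.+1 @^-1` B) =
   a%:E * P ([set w | forall i, (i < n)%N -> A i (X i w)] `&` X n @^-1` B))%E.
Proof.
move=> mA; elim: n B => [|n IHn] B mB.
  rewrite (_ : [set w | _] = setT); last by apply/seteqP; split.
  rewrite (_ : [set w | _] = setT); last by apply/seteqP; split.
  rewrite setIT setTI X_law// (law_survives mW nu_qsd X_chain X_law)//.
set F := _ `&` [set w | _]; set F' := [set w | _].
have sF : sigma_of [set k | (k <= n.+1)%N] X F.
  apply: (@measurableI _ (sigma_ofType [set k | (k <= n.+1)%N] X)).
    apply: (measurable_survives (T := sigma_ofType _ X) mW) => m m1.
    by apply: sigma_of_coord => /=; exact: leq_trans m1 _.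
  apply: (@measurable_setall _ (sigma_ofType [set k | (k <= n.+1)%N] X)) => i.
  have [im|im] := boolP (i < n.+1)%N; last first.
    rewrite (_ : [set w | _ -> A i (X i.+1 w)] = setT); first exact: measurableT.
    by apply/seteqP; split.
  apply: measurable_setimp; first exact: measurable_setprop.
  by apply: measurable_preim (mA i); exact: sigma_of_coord.
have sF' : sigma_of [set k | (k <= n)%N] X F'.
  apply: (@measurable_setall _ (sigma_ofType [set k | (k <= n)%N] X)) => i.
  have [im|im] := boolP (i < n.+1)%N; last first.
    rewrite (_ : [set w | _ -> A i (X i w)] = setT); first exact: measurableT.
    by apply/seteqP; split.
  apply: measurable_setimp; first exact: measurable_setprop.
  by apply: measurable_preim (mA i); exact: sigma_of_coord.
rewrite X_chain.2// [in RHS]X_chain.2//.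
apply: (ge0_integral_eq_law (Q := P) (Z' := X n) (h := skeleton_kernel D ^~ B)) => //.
- by apply: sigma_of_sub sF => i _.
- by apply: sigma_of_sub sF' => i _.
- exact: survival_rate_ge0.
- move=> C mC.
  have -> : F `&` X n.+1 @^-1` C =
      (survives X W 1 `&` [set w | forall i, (i < n)%N -> A i (X i.+1 w)]) `&`
      X n.+1 @^-1` (A n `&` C).
    apply/seteqP; split=> w.
      by move=> [[Sw /forall_ltnS[Aw Anw]] Cw]; split; split.
    by move=> [[Sw Aw] [Anw Cw]]; split=> //; split=> //; apply/forall_ltnS.
  have -> : F' `&` X n @^-1` C =
      [set w | forall i, (i < n)%N -> A i (X i w)] `&` X n @^-1` (A n `&` C).
    apply/seteqP; split=> w; first by move=> [/forall_ltnS[Aw Anw] Cw]; split=> //; split.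
    by move=> [Aw [Anw Cw]]; split=> //; apply/forall_ltnS.
  by apply: IHn; exact: measurableI.
- exact: measurable_skeleton_kernel.
- by move=> z; exact: skeleton_kernel_ge0.
Qed.

(** Both sides are finite measures in [E] that agree on the cylinders, a generating family stable
    under intersection. The [setT] gives the form expected by [ge0_integral_eq_law]. *)
Lemma law_shift (E : set path_space) : measurable E ->
  (P (survives X W 1 `&` path_from 1 @^-1` E) =
   a%:E * P (setT `&` path_from 0 @^-1` E))%E.
Proof.
move=> mE.
have mS : measurable (survives X W 1) by exact: measurable_survives.
have a0 : 0 <= a by exact: survival_rate_ge0.
have push (m : {measure set T -> \bar R}) k :
    {m' : {measure set path_space -> \bar R} | forall A, m' A = m (path_from k @^-1` A)}.
  unshelve refine (exist _ (pushforward m (path_from k) : {measure set _ -> \bar R}) _) => //.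
  exact: measurable_path_from.
have [m1 m1E] := push (mrestr P mS) 1%N.
have [m2 m2E] := push (mscale (NngNum a0) P) 0%N.
rewrite setTI.
transitivity (m1 E); first by rewrite m1E /= /mrestr setIC.
transitivity (m2 E); last by rewrite m2E.
apply: (g_sigma_algebra_measure_unique cylinder measurable_cylinder (fun=> setT)
  _ _ m1 m2 cylinderI).
- by move=> _; exists 0%N, (fun=> setT); split=> //; apply/seteqP; split.
- by apply/seteqP; split=> // x _; exists 0%N.
- move=> _ [n [A [mA ->]]]; rewrite m1E m2E /= /mrestr /mscale /=.
  have := cylinder_shift n mA (@measurableT _ _); rewrite !preimage_setT !setIT.
  by move=> <-; rewrite setIC.
- by move=> k; rewrite m1E preimage_setT /mrestr; apply: fin_num_fun_lty; exact: fin_num_measure.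
- exact: cylinder_generates.
Qed.

Lemma exit_sum_shift (g : chain_state R d -> R) w : W (X 0%N w) ->
  (exists n, ~ W (X n w)) ->
  exit_sum X W g w = g (X 0%N w) +
    (if `[< survives X W 1 w >] then exit_sum (fun n => X n.+1) W g w else 0).
Proof.
move=> W0 [n0 /(firstP (S := [set n | ~ W (X n w)]))[]].
rewrite -/(exit_time X W w) => nW _.
have beforeW m : (m < exit_time X W w)%N -> W (X m w).
  by move=> /first_min nnW; apply: contrapT.
rewrite /exit_sum; case M : (exit_time X W w) nW beforeW => [|m] nW beforeW.
  by case: nW.
rewrite big_ord_recl /=; congr (_ + _); case: asboolP => [S1|nS1].
  suff -> : exit_time (fun n => X n.+1) W w = m by [].
  apply/first_eq; left; split=> // k nWk; rewrite leqNgt; apply/negP => km.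
  exact: nWk (beforeW k.+1 km).
(* Without survival at step 1 the exit time is 1 and no later term remains. *)
case: m {M} nW beforeW => [|m] nW beforeW; first by rewrite big_ord0.
by case: nS1 => k k1; apply: beforeW; rewrite ltnS (leq_trans k1).
Qed.

(* Given survival at step 1, the sum from step 1 on has the law of the whole sum,
   so it is integrable as well; g (X 0) is the difference of the two. *)
Lemma integrable_exit_sum (g : chain_state R d -> R) : measurable_fun setT g ->
  {ae P, forall w, exists n, ~ W (X n w)} ->
  P.-integrable setT (EFin \o exit_sum X W g) ->
  (\int[nu]_z (`|g z|)%:E < +oo)%E.
Proof.
move=> mg X_exit /integrableP[_ iS].
have mabs d1 (U : measurableType d1) (h : U -> R) :
    measurable_fun setT h -> measurable_fun setT (fun x => (`|h x|)%:E).
  by move=> mh; apply/measurable_EFinP; exact: measurableT_comp.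
pose S k w := exit_sum (fun n => X (k + n)%N) W g w.
have mS k : measurable_fun setT (S k) by exact: measurable_exit_sum.
have mS1 : measurable (survives X W 1) by exact: measurable_survives.
have iSk : (\int[P]_(w in survives X W 1) (`|S 1%N w|)%:E =
            a%:E * \int[P]_w (`|S 0%N w|)%:E)%E.
  apply: (ge0_integral_eq_law (Q := P) (Z := path_from 1) (Z' := path_from 0)
    (h := fun x : path_space => (`|exit_sum (fun n (x : path_space) => x n) W g x|)%:E)) => //.
  - exact: measurable_path_from.
  - exact: measurable_path_from.
  - exact: survival_rate_ge0.
  - exact: law_shift.
  - by apply: mabs; apply: measurable_exit_sum => // n; exact: measurable_coord.
have -> : (\int[nu]_z (`|g z|)%:E = \int[P]_w (`|g (X 0%N w)|)%:E)%E.
  rewrite -[LHS]mul1e.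
  apply/esym/(ge0_integral_eq_law (Q := nu) (Z := X 0%N) (Z' := id) (h := fun x => (`|g x|)%:E)) => //.
  - by move=> B mB; rewrite !setTI mul1e; exact: X_law.
  - exact: mabs.
pose S1 := (fun w => (`|S 1%N w|)%:E) \_ (survives X W 1).
have mS1' : measurable_fun setT S1.
  by apply/(measurable_restrictT _ mS1); apply: measurable_funTS; exact: mabs.
have S1_ge0 w : (0 <= S1 w)%E by rewrite /S1 patchE; case: ifP => // _; rewrite lee_fin.
apply: (@le_lt_trans _ _ (\int[P]_w ((`|S 0%N w|)%:E + S1 w)))%E.
  apply: ae_ge0_le_integral => //.
  - by apply: mabs; exact: measurableT_comp.
  - by move=> w _; rewrite adde_ge0// lee_fin.
  - by apply: emeasurable_funD => //; exact: mabs.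
  have X_start := ae_start mW nu_qsd X_chain X_law.
  apply: filterS2 X_start X_exit => w W0 wexit _.
  rewrite /S1 patchE /S (exit_sum_shift g W0 wexit).
  case: asboolP => [S1w|nS1w]; last by rewrite memNset// adde0 addr0.
  rewrite mem_set// -EFinD lee_fin.
  set y := exit_sum (fun n => X n.+1) W g w.
  by rewrite -[X in (`|X| <= _)%R](addrK y); exact: ler_normB.
rewrite ge0_integralD//; last exact: mabs.
rewrite -integral_mkcond iSk.
have iS0 : (\int[P]_w (`|S 0%N w|)%:E < +oo)%E by [].
by rewrite lte_add_pinfty// lte_mul_pinfty// lee_fin; exact: survival_rate_ge0.
Qed.

End path_law.

(** * Expectations and exit laws along a schedule *)

Section semi_integrable_difference.
Context d (T : measurableType d) (R : realType) (mu : {measure set T -> \bar R}).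
Local Open Scope ereal_scope.

(** The functions [u] and [v] need not be the positive and negative parts of [u - v]. With [h] the
    difference, integrating the identity [h^\+ + v = h^\- + u] between nonnegative functions gives
    the claim even if one of the two integrals is infinite. *)
Lemma integral_difference (u v : T -> R) :
  measurable_fun setT u -> measurable_fun setT v ->
  (forall w, 0 <= u w)%R -> (forall w, 0 <= v w)%R ->
  \int[mu]_w (u w)%:E < +oo \/ \int[mu]_w (v w)%:E < +oo ->
  \int[mu]_w (u w - v w)%:E = \int[mu]_w (u w)%:E - \int[mu]_w (v w)%:E.
Proof.
move=> mu_ mv u0 v0 fin.
pose h w : \bar R := (u w - v w)%:E.
have mh : measurable_fun setT h by apply/measurable_EFinP; exact: measurable_funB.
have mEu : measurable_fun setT (EFin \o u) by exact/measurable_EFinP.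
have mEv : measurable_fun setT (EFin \o v) by exact/measurable_EFinP.
have mhp := measurable_funepos mh; have mhn := measurable_funeneg mh.
have hp_le : \int[mu]_w h^\+ w <= \int[mu]_w (u w)%:E.
  apply: ge0_le_integral => // w _.
  by rewrite funeposE /h -EFin_max lee_fin ge_max u0 andbT lerBlDr lerDl.
have hn_le : \int[mu]_w h^\- w <= \int[mu]_w (v w)%:E.
  apply: ge0_le_integral => // w _.
  by rewrite funenegE /h -EFinN -EFin_max lee_fin ge_max v0 andbT opprB lerBlDr lerDl.
have balance : \int[mu]_w h^\+ w + \int[mu]_w (v w)%:E =
               \int[mu]_w h^\- w + \int[mu]_w (u w)%:E.
  rewrite -!ge0_integralD//; try by move=> w _; rewrite lee_fin.
  apply: eq_integral => w _; rewrite funeposE funenegE /h -EFinN -!EFin_max -!EFinD.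
  congr EFin.
  by case: (leP (u w - v w)%R 0%R) => ?; case: (leP (- (u w - v w))%R 0%R) => ?; lra.
have hp0 : 0 <= \int[mu]_w h^\+ w by exact: integral_ge0.
have hn0 : 0 <= \int[mu]_w h^\- w by exact: integral_ge0.
have iu0 : 0 <= \int[mu]_w (u w)%:E by apply: integral_ge0 => w _; rewrite lee_fin.
have iv0 : 0 <= \int[mu]_w (v w)%:E by apply: integral_ge0 => w _; rewrite lee_fin.
rewrite integralE; move: balance hp_le hn_le hp0 hn0 iu0 iv0 fin.
move: (\int[mu]_w h^\+ w) (\int[mu]_w h^\- w) => [x| |] [y| |] //.
all: move: (\int[mu]_w (u w)%:E) (\int[mu]_w (v w)%:E) => [x'| |] [y'| |] //=.
- by move=> [] E *; rewrite -!EFinB; congr EFin; lra.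
all: by move=> _ _ _ _ _ _ _ [].
Qed.

End semi_integrable_difference.

Lemma history_cst_indep (R : realType) p d (T : measurableType d)
    (P : probability T R) (u : nat -> 'I_p.+1 * nat) k q (B : set T) :
  P ([set w | history (fun k _ => u k) k w = q] `&` B) =
  (P [set w | history (fun k _ => u k) k w = q] * P B)%E.
Proof.
have [E|E] := pselect (mkseq u k = q).
  rewrite (_ : [set w | _] = setT); last by apply/seteqP; split.
  by rewrite setTI probability_setT mul1e.
rewrite (_ : [set w | _] = set0); last by apply/seteqP; split.
by rewrite set0I measure0 mul0e.
Qed.

Section exit_laws.
Context (R : realType) (d : nat) (D : pdmp R d).
Context (W : set (chain_state R d)) (nu : probability (chain_state R d) R).
Hypotheses (mW : measurable W) (nu_qsd : is_qsd D W nu).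
Let a := survival_rate D W nu.
Hypothesis a_lt1 : a < 1.

(** Meant for nonnegative functions: a signed [g] enters through [g^\+] and [g^\-], whose totals are
    subtracted. *)
Definition expected_total (g : chain_state R d -> R) : \bar R :=
  (\sum_(k <oo) (a ^+ k)%:E * \int[nu]_z (g z)%:E)%E.

Definition escape_law (A : set (chain_state R d)) : \bar R :=
  (\sum_(k <oo) (a ^+ k * fine (next_law D nu (A `\` W)))%:E)%E.

Lemma expected_total_lty g : (forall z, 0 <= g z) ->
  (\int[nu]_z (g z)%:E < +oo)%E -> (expected_total g < +oo)%E.
Proof.
move=> g0 gfin.
have ig0 : (0 <= \int[nu]_z (g z)%:E)%E by apply: integral_ge0 => z _; rewrite lee_fin.
have [c cE] : exists c, (\int[nu]_z (g z)%:E = c%:E)%E.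
  by exists (fine (\int[nu]_z (g z)%:E)); rewrite fineK// ge0_fin_numE.
have a0 : 0 <= a by exact: survival_rate_ge0.
rewrite /expected_total cE (eq_eseriesr (g := fun k => (geometric c a k)%:E)); last first.
  by move=> k _; rewrite -EFinM mulrC.
rewrite (_ : (\sum_(_ <oo) _)%E = (c / (1 - a))%:E) ?ltry//.
apply/cvg_lim => //.
have := @cvg_geometric_series R c a.
rewrite ger0_norm// => /(_ a_lt1) cv.
rewrite (_ : (fun n => _) = EFin \o series (geometric c a)).
  by apply: cvg_EFin => //; exact: nearW.
by apply/funext => n /=; rewrite /series /= sumEFin.
Qed.

Section one_schedule.
Context (p : nat) d' (T : measurableType d') (P : probability T R).
Context (Y : 'I_p.+1 -> nat -> T -> chain_state R d).
Hypotheses (Y_chain : forall r, skeleton_chain D P (Y r)).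
Hypothesis (Y_law : forall r, has_law P (Y r 0%N) nu).
Hypothesis Y_indep : mutually_independent P (fun r => sigma_of setT (Y r)).
Context (s : nat -> T -> 'I_p.+1 * nat).
Hypothesis ms : forall k x, measurable [set w | s k w = x].
Hypothesis s_seq : {ae P, forall w, sequential (s ^~ w)}.
Hypothesis s_indep : forall k q B, sigma_of setT (fun rn => Y rn.1 rn.2) B ->
  P ([set w | history s k w = q] `&` B) =
  (P [set w | history s k w = q] * P B)%E.

Let mY r n : measurable_fun setT (Y r n) := (Y_chain r).1 n.
Let a01 : 0 <= a < 1. Proof. by rewrite survival_rate_ge0. Qed.
Let Y_start r : {ae P, forall w, W (Y r 0%N w)}.
Proof. exact (ae_start mW nu_qsd (Y_chain r) (@Y_law r)). Qed.
Let Y_surv r n B : measurable B ->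
  P (survives (Y r) W n `&` Y r n @^-1` B) = ((a ^+ n)%:E * nu B)%E.
Proof. exact: law_survives. Qed.

(** The value involves neither [Y] nor [s], which is how the three sums come to have the same
    expectation. *)
Lemma schedule_expectation (g : chain_state R d -> R) (F : T -> R) :
  measurable_fun setT g -> measurable_fun setT F ->
  {ae P, forall w, F w = scheduled_sum W Y s g w} ->
  (expected_total g^\+%R < +oo)%E \/ (expected_total g^\-%R < +oo)%E ->
  ('E_P[F] = expected_total g^\+%R - expected_total g^\-%R)%E.
Proof.
move=> mg mF FE fin.
have mgp := measurable_funrpos mg; have mgn := measurable_funrneg mg.
have mS (h : chain_state R d -> R) : measurable_fun setT h ->
  measurable_fun setT (scheduled_sum W Y s h) by exact: measurable_scheduled_sum.
have ES (h : chain_state R d -> R) : measurable_fun setT h -> (forall z, 0 <= h z) ->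
    (\int[P]_w (scheduled_sum W Y s h w)%:E = expected_total h)%E.
  by apply: expectation_scheduled_sum.
have S0 (h : chain_state R d -> R) w : (forall z, 0 <= h z) ->
  0 <= scheduled_sum W Y s h w by move=> h0; apply: sumr_ge0.
rewrite unlock -!ES//; rewrite -!ES// in fin.
rewrite -integral_difference//; [|exact: mS|exact: mS|by move=> w; exact: S0|by move=> w; exact: S0].
apply: ae_eq_integral => //.
- exact/measurable_EFinP.
- by apply/measurable_EFinP; apply: measurable_funB; exact: mS.
apply: filterS FE => w FE _ /=; rewrite FE; congr EFin.
rewrite /scheduled_sum -sumrB; apply: eq_bigr => k _.
by rewrite -[in LHS](funrposBneg g).
Qed.

Lemma schedule_state (Z : T -> chain_state R d) A :
  measurable_fun setT Z ->
  {ae P, forall w, Z w = current Y s 1 (stop W Y s w) w} ->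
  measurable A -> P (Z @^-1` A) = escape_law A.
Proof.
move=> mZ ZE mA; rewrite /escape_law.
rewrite -(law_stop mW mY ms s_seq s_indep Y_indep Y_start a01 Y_surv
  (m := fun B => fine (next_law D nu B)))//.
- apply: ae_eq_measure; first exact: measurable_preim.
    apply: (measurable_set_index (Q := fun k w => A (current Y s 1 k w))).
      exact: measurable_stop.
    by move=> k; apply: measurable_preim mA; exact: measurable_current.
  by apply: filterS ZE => w /= ->.
- move=> B; apply: fine_ge0; apply: integral_ge0 => z _; exact: skeleton_kernel_ge0.
- move=> r n B mB; rewrite (law_survives_next mW nu_qsd (Y_chain r) (Y_law r))//.
  by rewrite EFinM fineK//; apply: (next_law_fin_num mW nu_qsd (Y_chain r) (Y_law r)).
Qed.

End one_schedule.

Section single_chain.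
Context d' (T : measurableType d') (P : probability T R).
Context (X : nat -> T -> chain_state R d).
Hypotheses (X_chain : skeleton_chain D P X) (X_law : has_law P (X 0%N) nu).

Let Y (r : 'I_1) := X.
Let s (k : nat) (w : T) : 'I_1 * nat := (ord0, k).

Let s_seq w : sequential (s ^~ w).
Proof. by move=> k; rewrite /visits /= sum1_card card_ord. Qed.

Let s_indep k q (B : set T) :
  P ([set w | history s k w = q] `&` B) = (P [set w | history s k w = q] * P B)%E.
Proof. exact: history_cst_indep. Qed.

Let Y_indep : mutually_independent P (fun r => sigma_of setT (Y r)).
Proof.
move=> J A FA; have [J0|J0] := boolP (ord0 \in J).
  rewrite (bigD1 ord0)//= big1 ?mule1 => [|i /andP[_]]; last by rewrite ord1.
  congr (P _); apply/seteqP; split=> w; first exact.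
  by move=> Aw i _; rewrite ord1.
rewrite big1 => [|i]; last by rewrite ord1 (negbTE J0).
rewrite -[RHS](probability_setT P); congr (P _); apply/seteqP; split=> // w _ i /=.
by rewrite ord1 (negbTE J0).
Qed.

(** The stop is the last step inside [W], and the exit happens at its successor. Starting in [W]
    excludes an exit at time 0, which the schedule does not test. *)
Lemma exit_time_stop w : W (X 0%N w) -> (exists n, ~ W (X n w)) ->
  exit_time X W w = (stop W Y s w).+1.
Proof.
move=> W0 [n0 nW0]; apply/first_eq; left.
have nW1 : exists k, ~ W (current Y s 1 k w).
  by case: n0 nW0 => [//|n0] nW0; exists n0; rewrite /current addn1.
have [nW sE] := stopP nW1; split; first by move: nW; rewrite /current addn1.
move=> [//|m] nWm; rewrite ltnS.
have /firstP[_] : [set k | ~ W (current Y s 1 k w)] m by rewrite /= /current addn1.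
exact.
Qed.

Hypothesis X_exit : {ae P, forall w, exists n, ~ W (X n w)}.

Let ae_exit_time : {ae P, forall w, exit_time X W w = (stop W Y s w).+1}.
Proof.
have X_start := ae_start mW nu_qsd X_chain X_law.
by apply: filterS2 X_start X_exit => w; exact: exit_time_stop.
Qed.

Let ms k x : measurable [set w | s k w = x].
Proof. by have := @measurable_setprop _ T ((ord0, k) = x). Qed.

Lemma expectation_exit_sum (g : chain_state R d -> R) : measurable_fun setT g ->
  (expected_total g^\+%R < +oo)%E \/ (expected_total g^\-%R < +oo)%E ->
  ('E_P[exit_sum X W g] = expected_total g^\+%R - expected_total g^\-%R)%E.
Proof.
move=> mg; apply: (@schedule_expectation 0%N _ T P Y _ _ Y_indep s ms) => //.
- exact: nearW.
- by apply: measurable_exit_sum => //; exact: X_chain.1.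
- apply: filterS ae_exit_time => w eE; rewrite /exit_sum eE.
  by apply: eq_bigr => k _; rewrite /current addn0.
Qed.

Lemma law_exit_state A : measurable A ->
  P (exit_state X W @^-1` A) = escape_law A.
Proof.
move=> mA; apply: (@schedule_state 0%N _ T P Y _ _ Y_indep s ms) => //.
- exact: nearW.
- by apply: measurable_exit_state => //; exact: X_chain.1.
- by apply: filterS ae_exit_time => w eE; rewrite /exit_state eE /current addn1.
Qed.

(* In the integrable case, the positive and negative parts could a priori both have
   infinite expected totals: [integrable_exit_sum] rules this out. *)
Lemma expected_total_of_exit_sum (g : chain_state R d -> R) : measurable_fun setT g ->
  exit_sum_has_expectation W g P X ->
  (expected_total g^\+%R < +oo)%E \/ (expected_total g^\-%R < +oo)%E.
Proof.
move=> mg.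
(* For nonnegative [h] the negative part has total zero, so [expectation_exit_sum] applies and
   identifies the total of [h] with the expectation of its exit sum. *)
have pos (h : chain_state R d -> R) : measurable_fun setT h -> (forall z, 0 <= h z) ->
    ('E_P[exit_sum X W h] < +oo)%E -> (expected_total h < +oo)%E.
  move=> mh h0.
  have hn : h^\-%R = cst 0 by apply/funext => z; rewrite /funrneg max_r// oppr_le0.
  have hp : h^\+%R = h by apply/funext => z; rewrite /funrpos max_l.
  have en0 : expected_total h^\-%R = 0%E.
    rewrite /expected_total hn; apply: eseries0 => k _ _; by rewrite integral0 mule0.
  have fin : (expected_total h^\+%R < +oo)%E \/ (expected_total h^\-%R < +oo)%E.
    by right; rewrite en0.
  by rewrite (expectation_exit_sum mh fin) en0 hp sube0.
case=> [iX|fin|fin].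
- left; apply: expected_total_lty => //.
  apply: le_lt_trans (integrable_exit_sum mW nu_qsd X_chain X_law mg X_exit iX).
  apply: ge0_le_integral => //.
  + by move=> z _; rewrite lee_fin.
  + by apply/measurable_EFinP; exact: measurable_funrpos.
  + by apply/measurable_EFinP; exact: measurableT_comp.
  + by move=> z _; rewrite lee_fin /funrpos ge_max ler_norm normr_ge0.
- by left; apply: pos => //; exact: measurable_funrpos.
- by right; apply: pos => //; exact: measurable_funrneg.
Qed.

End single_chain.

End exit_laws.

(** * The synchronous step *)

Section round_robin.
Context (p : nat).

Definition round_robin (k : nat) : 'I_p.+1 * nat := (inord (k %% p.+1), k %/ p.+1)%N.

Lemma round_robinE n (r : 'I_p.+1) : round_robin (n * p.+1 + r) = (r, n).
Proof.
rewrite /round_robin divnMDl// divn_small// addn0 modnMDl modn_small//.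
by congr pair; apply: val_inj; rewrite /= inordK.
Qed.

Lemma round_robin_val k : k = ((round_robin k).2 * p.+1 + (round_robin k).1)%N.
Proof. by rewrite /round_robin /= inordK ?ltn_mod// -divn_eq. Qed.

Lemma sequential_round_robin : sequential round_robin.
Proof.
apply: sequential_enum => [r m|j k jk|j k _ jk].
- by exists (m * p.+1 + r)%N; exact: round_robinE.
- by rewrite (round_robin_val j) (round_robin_val k) jk.
- by rewrite ltnNge; apply/negP => /(leq_div2r p.+1); rewrite leqNgt jk.
Qed.

(** This is the shape of [sync_sum]: full rounds, then a last round cut at replica [j], with [n] the
    synchronous step minus one. *)
Lemma sum_round_robin (V : nmodType) (F : 'I_p.+1 * nat -> V) n (j : 'I_p.+1) :
  \sum_(k < (n * p.+1 + j).+1) F (round_robin k) =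
  \sum_(i < n) \sum_(r < p.+1) F (r, i : nat) +
  \sum_(r < p.+1 | (r <= j)%N) F (r, n).
Proof.
rewrite -addnS -[LHS](big_mkord xpredT (fun k => F (round_robin k))).
rewrite (big_cat_nat (n := (n * p.+1)%N))//= ?leq_addr//; congr (_ + _).
  elim: n => [|n IHn]; first by rewrite mul0n big_geq// big_ord0.
  rewrite mulSn addnC (big_cat_nat (n := (n * p.+1)%N))//= ?leq_addr// IHn big_ord_recr/=.
  congr (_ + _); rewrite -{1}[(n * p.+1)%N]add0n big_addn addKn big_mkord.
  by apply: eq_bigr => r _; rewrite addnC round_robinE.
rewrite -{1}[(n * p.+1)%N]add0n big_addn addKn big_mkord.
rewrite (big_ord_widen p.+1 (fun i => F (round_robin (i + n * p.+1)))) ?ltn_ord//.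
by apply: eq_big => [r|r _]; rewrite ?ltnS// addnC round_robinE.
Qed.

End round_robin.

Section synchronous.
Context (R : realType) (d p : nat) (W : set (chain_state R d)).
Context d' (T : measurableType d') (Y : 'I_p.+1 -> nat -> T -> chain_state R d).
Hypotheses (mW : measurable W) (mY : forall r n, measurable_fun setT (Y r n)).

Let s (k : nat) (w : T) := round_robin p k.

(** Round robin meets exits in lexicographic order of step, then replica. An exit is met when the
    preceding step of its replica is processed, hence the predecessor, which is genuine because the
    synchronous step is positive. *)
Lemma sync_stop w : (forall r, W (Y r 0%N w)) ->
  (exists k, ~ W (current Y s 1 k w)) ->
  round_robin p (stop W Y s w) = (sync_index Y W w, (sync_step Y W w).-1) /\
  (0 < sync_step Y W w)%N.
Proof.
move=> W0 [k0 nW0]; set N := sync_step Y W w.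
have nWk k : ~ W (current Y s 1 k w) -> exists r, ~ W (Y r (k %/ p.+1).+1 w).
  by rewrite /current addn1; exists (round_robin p k).1.
have [[r0 nWr0] minN] : (exists r, ~ W (Y r N w)) /\
    forall n, (exists r, ~ W (Y r n w)) -> (N <= n)%N.
  have [? _] := firstP (S := [set n | exists r, ~ W (Y r n w)]) (nWk _ nW0).
  by split=> // n /(firstP (S := [set n | exists r, ~ W (Y r n w)]))[].
have N0 : (0 < N)%N by rewrite lt0n; apply/negP => /eqP N0; apply: nWr0; rewrite N0.
split=> //.
pose J := sync_index Y W w.
have [nWJ minJ] : ~ W (Y J N w) /\ forall r, ~ W (Y r N w) -> (J <= r)%N.
  (* The default [ord0] need not be an exiting replica, so [arg_minnP] is started from [r0] to
     refute the default branch. *)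
  rewrite /J /sync_index /arg_min /extremum; case: pickP => [j /andP[/asboolP nWj /forallP minj]|noj].
    split=> // r nWr.
    by have /implyP -/(_ (asboolT nWr)) := minj r.
  have [j nWj minj] := @arg_minnP _ r0 (fun r => `[< ~ W (Y r N w) >])
    (fun r : 'I_p.+1 => r : nat) (asboolT nWr0).
  have := noj j; rewrite /= nWj /= => /negP[]; apply/forallP => r; apply/implyP.
  exact: minj.
have -> : stop W Y s w = (N.-1 * p.+1 + J)%N.
  apply/first_eq; left; split=> [|k nW].
    by rewrite /= /current /s round_robinE addn1 prednK.
  have Nk : (N <= (k %/ p.+1).+1)%N by apply: minN; exact: nWk.
  rewrite [k in (_ <= k)%N](round_robin_val p k) /=.
  (* Within the same round the minimality of [J] decides; a later round starts beyond all of it. *)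
  move: Nk; rewrite leq_eqVlt => /predU1P[Nk|Nk].
    rewrite Nk /= leq_add2l; apply: minJ; rewrite Nk.
    by move: nW; rewrite /= /current addn1.
  apply: (@leq_trans (k %/ p.+1 * p.+1)%N); last exact: leq_addr.
  rewrite -(prednK N0) ltnS in Nk.
  apply: leq_trans (leq_mul Nk (leqnn p.+1)).
  by rewrite mulSn addnC leq_add2r ltnW.
exact: round_robinE.
Qed.

Lemma sync_sum_scheduled (g : chain_state R d -> R) w : (forall r, W (Y r 0%N w)) ->
  (exists k, ~ W (current Y s 1 k w)) ->
  sync_sum Y W g w = scheduled_sum W Y s g w.
Proof.
move=> W0 nW; have [KE _] := sync_stop W0 nW.
rewrite /scheduled_sum (round_robin_val p (stop W Y s w)) KE /=.
rewrite (eq_bigr (fun k : 'I__ => (fun x => g (Y x.1 x.2 w)) (round_robin p k))); last first.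
  by move=> k _; rewrite /current addn0.
by rewrite (sum_round_robin (fun x => g (Y x.1 x.2 w))).
Qed.

Lemma sync_state_scheduled w : (forall r, W (Y r 0%N w)) ->
  (exists k, ~ W (current Y s 1 k w)) ->
  sync_state Y W w = current Y s 1 (stop W Y s w) w.
Proof.
move=> W0 nW; have [KE N0] := sync_stop W0 nW.
by rewrite /current /s KE /= addn1 prednK.
Qed.

Lemma measurable_sync_step n : measurable [set w | sync_step Y W w = n].
Proof.
apply: measurable_first => k; apply: measurable_setex => r.
exact: measurable_setnot (measurable_preim (mY r k) mW).
Qed.

(** The arg min sees the outcome only through the vector of exit indicators at the synchronous step,
    which has finitely many values. *)
Lemma measurable_sync_index r : measurable [set w | sync_index Y W w = r].
Proof.
pose least (b : {ffun 'I_p.+1 -> bool}) := [arg min_(r < ord0 | b r) (r : nat)]%N.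
pose exits n w := [ffun r => `[< ~ W (Y r n w) >]].
have indexE w : sync_index Y W w = least (exits (sync_step Y W w) w).
  rewrite /sync_index /least; congr (arg_min _ _ _).
  by apply/funext => i; rewrite ffunE.
rewrite (_ : [set _ | _] = [set w | least (exits (sync_step Y W w) w) = r]); last first.
  by apply/seteqP; split=> w /=; rewrite indexE.
apply: (measurable_set_index (Q := fun n w => least (exits n w) = r) measurable_sync_step) => n.
apply: (measurable_set_index (Q := fun b _ => least b = r)) => b; last exact: measurable_setprop.
rewrite (_ : [set _ | _] = [set w | forall i, `[< ~ W (Y i n w) >] = b i]); last first.
  apply/seteqP; split=> w /=; first by move=> <- i; rewrite ffunE.
  by move=> eb; apply/ffunP => i; rewrite ffunE.
apply: measurable_setall => i.
have mi : measurable [set w | W (Y i n w)] by exact: measurable_preim (mY i n) mW.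
case: (b i).
  rewrite (_ : [set _ | _] = [set w | ~ W (Y i n w)]); first exact: measurable_setnot.
  by apply/seteqP; split=> w /= /asboolP.
rewrite (_ : [set _ | _] = [set w | W (Y i n w)])//.
apply/seteqP; split=> w /=; first by move=> /asboolPn/contrapT.
by move=> Wi; apply/asboolPn.
Qed.

Let measurable_step_index (x : nat * 'I_p.+1) :
  measurable [set w | (sync_step Y W w, sync_index Y W w) = x].
Proof.
rewrite (_ : [set _ | _] = [set w | sync_step Y W w = x.1 /\ sync_index Y W w = x.2]).
  by apply: measurable_setand; [exact: measurable_sync_step|exact: measurable_sync_index].
by apply/seteqP; split=> w /=; [move=> <-|case: x => ? ? /= [-> ->]].
Qed.

Lemma measurable_sync_sum (g : chain_state R d -> R) :
  measurable_fun setT g -> measurable_fun setT (sync_sum Y W g).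
Proof.
move=> mg; apply: (measurable_fun_index (F := fun (x : nat * 'I_p.+1) w =>
  \sum_(n < x.1.-1) \sum_(r < p.+1) g (Y r n w) +
  \sum_(r < p.+1 | (r <= x.2)%N) g (Y r x.1.-1 w)) measurable_step_index) => x.
have mgY r n : measurable_fun setT (fun w => g (Y r n w)) by exact: measurableT_comp.
apply: measurable_funD; first by do 2 apply: measurable_sum => ?.
under eq_fun do rewrite -big_filter.
exact: measurable_sum.
Qed.

Lemma measurable_sync_state : measurable_fun setT (sync_state Y W).
Proof.
exact: (measurable_fun_index (F := fun (x : nat * 'I_p.+1) w => Y x.2 x.1 w)
  measurable_step_index).
Qed.

End synchronous.

(** * The asynchronous step *)

Section wall_clock.
Context (R : realType) (p : nat).
Implicit Types (t : 'I_p.+1 -> nat -> R) (u : nat -> 'I_p.+1 * nat).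

Lemma wall_order_mono t u : wall_order t u ->
  {mono (fun k => t (u k).1 (u k).2) : j k / (j < k)%N >-> j < k}.
Proof.
move=> [_ tS]; apply: leW_mono; apply: le_mono.
exact/(homo_ltn lt_trans).
Qed.

Lemma sequential_wall_order t u :
  (forall r m n, (m <= n)%N -> t r m <= t r n) -> wall_order t u -> sequential u.
Proof.
move=> tmono tu; have mono := wall_order_mono tu.
have inj j k : u j = u k -> j = k.
  move=> ujk; case: (ltngtP j k) => // [jk|kj].
    by have := mono j k; rewrite ujk ltxx jk.
  by have := mono k j; rewrite ujk ltxx kj.
apply: sequential_enum => [||j k jk1 jk2] //; first exact: tu.1.
case: (ltngtP j k) => // [kj|jk]; last by move: jk2; rewrite jk ltnn.
have := mono k j; rewrite kj => /idP.
by rewrite ltNge jk1 tmono// ltnW.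
Qed.

Definition pair_of_nat (n : nat) : 'I_p.+1 * nat := odflt (ord0, 0%N) (unpickle n).

(* Ties are broken by a fixed enumeration of the pairs, and not by choice, so that
   the result depends measurably on the wall-clock times. *)
Definition earliest t (Q : 'I_p.+1 * nat -> Prop) : 'I_p.+1 * nat :=
  pair_of_nat (first [set n | Q (pair_of_nat n) /\
    forall y, Q y -> t (pair_of_nat n).1 (pair_of_nat n).2 <= t y.1 y.2]).

Fixpoint greedy t (k : nat) : 'I_p.+1 * nat :=
  if k is k'.+1 then
    earliest t (fun y => t (greedy t k').1 (greedy t k').2 < t y.1 y.2)
  else earliest t (fun=> True).

Lemma earliestE t (Q : 'I_p.+1 * nat -> Prop) x : Q x ->
  (forall y, Q y -> y <> x -> t x.1 x.2 < t y.1 y.2) -> earliest t Q = x.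
Proof.
move=> Qx xmin.
have xN : pair_of_nat (pickle x) = x by rewrite /pair_of_nat pickleK.
have [] := @firstP [set n | Q (pair_of_nat n) /\
    forall y, Q y -> t (pair_of_nat n).1 (pair_of_nat n).2 <= t y.1 y.2] (pickle x).
  split; rewrite xN// => y Qy; have [->//|/eqP yx] := eqVneq y x.
  exact/ltW/xmin.
rewrite -/(earliest t Q) => -[QE minE] _; apply: contrapT => Ex.
by have := xmin _ QE Ex; rewrite ltNge minE.
Qed.

(** In a wall order the successor of [u k] is the earliest pair strictly later than it. This
    identifies the sequence picked by choice in [async_order] with a recursion whose steps are
    measurable in the clock times. *)
Lemma greedyE t u : wall_order t u -> greedy t = u.
Proof.
move=> tu; have mono := wall_order_mono tu; have [usurj _] := tu.
have uE (y : 'I_p.+1 * nat) : exists k, y = u k.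
  by have [k uk] := usurj y.1 y.2; exists k; rewrite uk -surjective_pairing.
apply/funext; elim=> [|k IHk] /=.
  apply: earliestE => // y _; have [j ->] := uE y => ju.
  by rewrite mono lt0n; apply/negP => /eqP j0; apply: ju; rewrite j0.
rewrite IHk; apply: earliestE; first by rewrite mono.
move=> y; have [j ->] := uE y; rewrite mono => kj ju.
by rewrite mono ltn_neqAle kj andbT; apply/negP => /eqP jk; apply: ju; rewrite jk.
Qed.

Context d' (T : measurableType d') (tw : 'I_p.+1 -> nat -> T -> R).

Lemma async_orderE w u : wall_order (fun r m => tw r m w) u -> async_order tw w = u.
Proof.
move=> tu; rewrite /async_order; case: xgetP => [u' _ tu'|/(_ _ tu)//].
by rewrite -(greedyE tu) (greedyE tu').
Qed.

(** A wall order exists exactly when the greedy sequence is one, which is a countable condition on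
    the clock times; otherwise [async_order] takes its default value. *)
Lemma async_order_greedy w k x : async_order tw w k = x <->
  (wall_order (fun r m => tw r m w) (greedy (fun r m => tw r m w)) /\
     greedy (fun r m => tw r m w) k = x) \/
  (~ wall_order (fun r m => tw r m w) (greedy (fun r m => tw r m w)) /\
     (ord0, 0%N) = x).
Proof.
have [wg|nwg] := pselect (wall_order (fun r m => tw r m w) (greedy (fun r m => tw r m w))).
  by rewrite (async_orderE wg); split=> [|[[]|[]]//]; left.
have -> : async_order tw w k = (ord0, 0%N).
  rewrite /async_order; case: xgetP => // u _ tu; exfalso; apply: nwg.
  by rewrite (greedyE tu).
by split=> [|[[]|[]]//]; right.
Qed.

Hypothesis mtw : forall r m, measurable_fun setT (tw r m).

Let measurable_lt x y : measurable [set w | tw x.1 x.2 w < tw y.1 y.2 w].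
Proof.
rewrite (_ : [set _ | _] = [set w | ~ (tw y.1 y.2 w <= tw x.1 x.2 w)]).
  by apply: measurable_setnot; exact: measurable_set_ler.
by apply/seteqP; split=> w /=; rewrite ltNge => /negP.
Qed.

Lemma measurable_earliest (Q : T -> 'I_p.+1 * nat -> Prop) x :
  (forall y, measurable [set w | Q w y]) ->
  measurable [set w | earliest (fun r m => tw r m w) (Q w) = x].
Proof.
move=> mQ; rewrite /earliest.
apply: (measurable_set_index (Q := fun n _ => pair_of_nat n = x)) => n; last exact: measurable_setprop.
apply: measurable_first => k.
apply: measurable_setand => //; apply: measurable_setall => y.
by apply: measurable_setimp => //; exact: measurable_set_ler.
Qed.

Lemma measurable_greedy k x : measurable [set w | greedy (fun r m => tw r m w) k = x].
Proof.
elim: k x => [|k IHk] x /=.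
  apply: (measurable_earliest (Q := fun _ _ => True)) => y; exact: measurable_setprop.
apply: (measurable_set_index (Q := fun z w => earliest (fun r m => tw r m w)
  (fun y => tw z.1 z.2 w < tw y.1 y.2 w) = x)) => // z.
exact: (measurable_earliest (Q := fun w y => tw z.1 z.2 w < tw y.1 y.2 w)).
Qed.

Lemma measurable_async_order k x : measurable [set w | async_order tw w k = x].
Proof.
have mwo : measurable [set w |
    wall_order (fun r m => tw r m w) (greedy (fun r m => tw r m w))].
  apply: measurable_setand.
    apply: measurable_setall => r; apply: measurable_setall => m.
    by apply: measurable_setex => j; exact: measurable_greedy.
  apply: measurable_setall => j.
  apply: (measurable_set_index (Q := fun z w => tw z.1 z.2 w <
    tw (greedy (fun r m => tw r m w) j.+1).1 (greedy (fun r m => tw r m w) j.+1).2 w)).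
    exact: measurable_greedy.
  move=> z; apply: (measurable_set_index (Q := fun y w => tw z.1 z.2 w < tw y.1 y.2 w)) => //.
  exact: measurable_greedy.
rewrite (_ : [set _ | _] = [set w |
    (wall_order (fun r m => tw r m w) (greedy (fun r m => tw r m w)) /\
     greedy (fun r m => tw r m w) k = x)] `|` [set w |
    (~ wall_order (fun r m => tw r m w) (greedy (fun r m => tw r m w)) /\
     (ord0, 0%N) = x)]); last first.
  by apply/seteqP; split=> w /=; rewrite async_order_greedy.
apply: measurableU; apply: measurable_setand => //.
- exact: measurable_greedy.
- exact: measurable_setnot.
- exact: measurable_setprop.
Qed.

End wall_clock.

Section asynchronous.
Context (R : realType) (d p : nat) (W : set (chain_state R d)).
Context d' (T : measurableType d') (Y : 'I_p.+1 -> nat -> T -> chain_state R d).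
Context (tw : 'I_p.+1 -> nat -> T -> R).

Let s (k : nat) (w : T) := async_order tw w k.

Section one_outcome.
Context (w : T).
Hypotheses (W0 : forall r, W (Y r 0%N w)) (Wexit : forall r, exists n, ~ W (Y r n w)).
Hypotheses (s_seq : sequential (s ^~ w)) (sW : exists k, ~ W (current Y s 1 k w)).

Let exit_seen k r m : (m < visits (s ^~ w) r k)%N ->
  exit_time (Y r) W w = m.+1 -> exists2 j, (j < k)%N & ~ W (current Y s 1 j w).
Proof.
move=> /(visitsP _ _ (fun j _ => s_seq j))[j jk sj] eE; exists j => //.
rewrite /current sj /= addn1 -eE.
have [n nW] := Wexit r.
by have [] := firstP (S := [set n | ~ W (Y r n w)]) nW.
Qed.

Let exit_time_gt0 r : exists m, exit_time (Y r) W w = m.+1.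
Proof.
case E : (exit_time (Y r) W w) => [|m]; last by exists m.
have [n nW] := Wexit r.
have [] := firstP (S := [set n | ~ W (Y r n w)]) nW.
by rewrite -/(exit_time (Y r) W w) E /= => /(_ (W0 r)).
Qed.

Let exit_time_le r m : ~ W (Y r m w) -> (exit_time (Y r) W w <= m)%N.
Proof. by move=> nW; have [] := firstP (S := [set n | ~ W (Y r n w)]) nW. Qed.

(** The asynchronous rule fires when the replica exits at or before its next step, whereas [stop]
    tests that next state alone, and a chain may re-enter [W]. Both fire first at the same stage:
    since steps are visited in order, an earlier exit would have been detected at an earlier
    visit. *)
Lemma async_step_stop : async_step Y W tw w = stop W Y s w.
Proof.
have [nW aliveE] := stopP sW.
apply/first_eq; left; split=> [|k ek].
  by apply: exit_time_le; move: nW; rewrite /current addn1.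
rewrite leqNgt; apply/negP => /aliveE al.
have [m eE] := exit_time_gt0 (s k w).1.
have mv : (m < visits (s ^~ w) (s k w).1 k.+1)%N.
  by rewrite visitsS eqxx addn1 ltnS -s_seq -ltnS -eE.
have [j jk nWj] := exit_seen mv eE.
exact: nWj (al _ jk).
Qed.

(** The state after the last processed step lies outside [W], which bounds the exit time of that
    replica; a smaller exit time would have been detected before the stop. *)
Lemma async_state_scheduled :
  async_state Y W tw w = current Y s 1 (stop W Y s w) w.
Proof.
rewrite /async_state async_step_stop /exit_state /current addn1.
have [nW aliveE] := stopP sW; set K := stop W Y s w in nW aliveE *.
have [m eE] := exit_time_gt0 (s K w).1.
rewrite -/(s K w) eE; suff -> : m = (s K w).2 by [].
apply/eqP; rewrite eqn_leq; apply/andP; split.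
  by rewrite -ltnS -eE; apply: exit_time_le; move: nW; rewrite /current addn1.
rewrite leqNgt; apply/negP => mK.
have mv : (m < visits (s ^~ w) (s K w).1 K)%N by rewrite -s_seq.
have [j jK nWj] := exit_seen mv eE.
exact: nWj ((aliveE K).2 (leqnn K) _ jK).
Qed.

Lemma async_sum_scheduled (g : chain_state R d -> R) :
  async_sum Y W g tw w = scheduled_sum W Y s g w.
Proof.
rewrite /async_sum async_step_stop; apply: eq_bigr => k _.
by rewrite /current addn0.
Qed.

End one_outcome.

Hypotheses (mW : measurable W) (mY : forall r n, measurable_fun setT (Y r n)).
Hypothesis mtw : forall r m, measurable_fun setT (tw r m).

Lemma measurable_async_step n : measurable [set w | async_step Y W tw w = n].
Proof.
apply: measurable_first => k.
apply: (measurable_set_index (Q := fun x w => (exit_time (Y x.1) W w <= x.2.+1)%N)).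
  exact: measurable_async_order.
move=> x; apply: (measurable_set_index (Q := fun n _ => (n <= x.2.+1)%N)) => m.
  exact: measurable_exit_time.
exact: measurable_setprop.
Qed.

Lemma measurable_async_sum (g : chain_state R d -> R) :
  measurable_fun setT g -> measurable_fun setT (async_sum Y W g tw).
Proof.
move=> mg; apply: (measurable_fun_index (F := fun n w =>
  \sum_(k < n.+1) g (Y (async_order tw w k).1 (async_order tw w k).2 w))
  measurable_async_step) => n.
apply: measurable_sum => k.
apply: (measurable_fun_index (idx := fun w => async_order tw w k)
  (F := fun x w => g (Y x.1 x.2 w))) => x; first exact: measurable_async_order.
exact: measurableT_comp.
Qed.

Lemma measurable_async_state : measurable_fun setT (async_state Y W tw).
Proof.
apply: (measurable_fun_index (F := fun n w => exit_state (Y (async_order tw w n).1) W w)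
  measurable_async_step) => n.
apply: (measurable_fun_index (idx := fun w => async_order tw w n)
  (F := fun x w => exit_state (Y x.1) W w)) => x; first exact: measurable_async_order.
exact: measurable_exit_state.
Qed.

(** Measurability of the order, read over the sigma-algebra of the clock times, turns the
    independence assumed on [tw] into the independence of histories asked of a schedule. *)
Lemma history_sigma_of k q : sigma_of setT (fun rm => tw rm.1 rm.2)
  [set w | history s k w = q].
Proof.
have mtw' r m : measurable_fun setT
    (tw r m : sigma_ofType setT (fun rm : 'I_p.+1 * nat => tw rm.1 rm.2) -> R).
  exact: (sigma_of_coord (X := fun rm : 'I_p.+1 * nat => tw rm.1 rm.2) (i := (r, m))).
apply: (measurable_history
  (T := sigma_ofType setT (fun rm : 'I_p.+1 * nat => tw rm.1 rm.2))) => j x.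
exact: (measurable_async_order mtw').
Qed.

End asynchronous.

Unset Implicit Arguments.
Set Strict Implicit.

Theorem theorem8p2 (R : realType) (d : nat) (D : pdmp R d)
  (hstat : has_stationary_distribution D)
  (f : borelRd R d -> R) (f_meas : measurable_fun setT f)
  (f_bounded : [bounded f x | x in setT])
  (W : set (chain_state R d)) (W_meas : measurable W)
  (W_ge0 : W `<=` [set z | 0 <= z.2])
  (nu : probability (chain_state R d) R) (nu_qsd : is_qsd D W nu)
  (nu_unique : qsd_unique D W nu) (nu_limit : qsd_limit D W nu)
  (dT : measure_display) (T : measurableType dT) (P : probability T R)
  (X : nat -> T -> chain_state R d) (X_chain : skeleton_chain D P X)
  (X_law : has_law P (X 0%N) nu)
  (X_exit : {ae P, forall w, exists n, ~ W (X n w)})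
  (p : nat) (Y : 'I_p.+1 -> nat -> T -> chain_state R d)
  (Y_chain : forall r, skeleton_chain D P (Y r))
  (Y_law : forall r, has_law P (Y r 0%N) nu)
  (Y_indep : mutually_independent P (fun r => sigma_of setT (Y r))) :
  let g := path_integral D f in
  ((exit_sum_has_expectation W g P X ->
      'E_P[sync_sum Y W g] = 'E_P[exit_sum X W g])%E /\
   (forall A, measurable A ->
      P (sync_state Y W @^-1` A) = P (exit_state X W @^-1` A))) /\
  (forall tw : 'I_p.+1 -> nat -> T -> R,
   (forall r m, measurable_fun setT (tw r m)) ->
   (forall r m w, 0 <= tw r m w) ->
   independent2 P (sigma_of setT (fun rm => tw rm.1 rm.2))
                  (sigma_of setT (fun rn => Y rn.1 rn.2)) ->
   {ae P, forall w, forall r m n, (m <= n)%N -> tw r m w <= tw r n w} ->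
   {ae P, forall w, exists! s, wall_order (fun r m => tw r m w) s} ->
   (exit_sum_has_expectation W g P X ->
      'E_P[async_sum Y W g tw] = 'E_P[exit_sum X W g])%E /\
   (forall A, measurable A ->
      P (async_state Y W tw @^-1` A) = P (exit_state X W @^-1` A))).
Proof.
move=> g.
have mg : measurable_fun setT g by exact: measurable_path_integral.
have a1 : survival_rate D W nu < 1 by exact: survival_rate_lt1 X_exit.
have mY r n : measurable_fun setT (Y r n) := (Y_chain r).1 n.
have a01 : 0 <= survival_rate D W nu < 1 by rewrite survival_rate_ge0.
have Yr_start r : {ae P, forall w, W (Y r 0%N w)}.
  exact (ae_start W_meas nu_qsd (Y_chain r) (@Y_law r)).
have Y_start : {ae P, forall w, forall r, W (Y r 0%N w)} by exact: filter_forall.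
have Y_surv r n B : measurable B ->
    P (survives (Y r) W n `&` Y r n @^-1` B) =
    ((survival_rate D W nu ^+ n)%:E * nu B)%E by exact: law_survives.
have Y_exit : {ae P, forall w, forall r, exists n, ~ W (Y r n w)}.
  apply: filter_forall => r.
  exact (ae_exit W_meas nu_qsd (Y_chain r) (@Y_law r) a1).
split.
  pose s (k : nat) (w : T) := round_robin p k.
  have ms k x : measurable [set w | s k w = x].
    by have := @measurable_setprop _ T (round_robin p k = x).
  have s_seq : {ae P, forall w, sequential (s ^~ w)}.
    by apply: nearW => w; exact: sequential_round_robin.
  have s_indep k q B : sigma_of setT (fun rn => Y rn.1 rn.2) B ->
      P ([set w | history s k w = q] `&` B) = (P [set w | history s k w = q] * P B)%E.
    by move=> _; exact: history_cst_indep.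
  have s_stop := ae_stop W_meas mY ms s_seq s_indep Y_indep Yr_start a01 Y_surv.
  split=> [gX|A mA].
    have fin := expected_total_of_exit_sum W_meas nu_qsd a1 X_chain X_law X_exit mg gX.
    (* Both expectations reduce to the same difference of expected totals. *)
    rewrite (expectation_exit_sum W_meas nu_qsd a1 X_chain X_law X_exit mg fin).
    apply: (schedule_expectation W_meas nu_qsd a1 Y_chain Y_law Y_indep ms s_seq s_indep mg _ _ fin).
      exact: measurable_sync_sum.
    by apply: filterS2 Y_start s_stop => w; exact: sync_sum_scheduled.
  rewrite (law_exit_state W_meas nu_qsd a1 X_chain X_law X_exit mA).
  apply: (schedule_state W_meas nu_qsd a1 Y_chain Y_law Y_indep ms s_seq s_indep _ _ mA).
    exact: measurable_sync_state.
  by apply: filterS2 Y_start s_stop => w; exact: sync_state_scheduled.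
move=> tw mtw tw0 tw_indep tw_mono tw_order.
pose s (k : nat) (w : T) := async_order tw w k.
have ms k x : measurable [set w | s k w = x] by exact: measurable_async_order.
have s_seq : {ae P, forall w, sequential (s ^~ w)}.
  apply: filterS2 tw_mono tw_order => w mono [u [wu _]].
  rewrite (_ : s ^~ w = u); last exact: async_orderE.
  exact: sequential_wall_order wu.
have s_indep k q B : sigma_of setT (fun rn => Y rn.1 rn.2) B ->
    P ([set w | history s k w = q] `&` B) = (P [set w | history s k w = q] * P B)%E.
  by apply: tw_indep; exact: history_sigma_of.
have s_stop := ae_stop W_meas mY ms s_seq s_indep Y_indep Yr_start a01 Y_surv.
have good : {ae P, forall w, [/\ forall r, W (Y r 0%N w),
    forall r, exists n, ~ W (Y r n w), sequential (s ^~ w) &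
    exists k, ~ W (current Y s 1 k w)]}.
  by apply: filterS2 (filterI Y_start Y_exit) (filterI s_seq s_stop) => w [? ?] [? ?].
split=> [gX|A mA].
  have fin := expected_total_of_exit_sum W_meas nu_qsd a1 X_chain X_law X_exit mg gX.
  rewrite (expectation_exit_sum W_meas nu_qsd a1 X_chain X_law X_exit mg fin).
  apply: (schedule_expectation W_meas nu_qsd a1 Y_chain Y_law Y_indep ms s_seq s_indep mg _ _ fin).
    exact: measurable_async_sum.
  by apply: filterS good => w [W0 nW sw kw]; exact: async_sum_scheduled.
rewrite (law_exit_state W_meas nu_qsd a1 X_chain X_law X_exit mA).
apply: (schedule_state W_meas nu_qsd a1 Y_chain Y_law Y_indep ms s_seq s_indep _ _ mA).
  exact: measurable_async_state.
by apply: filterS good => w [W0 nW sw kw]; exact: async_state_scheduled.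
Qed.
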